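(* Let $n\ge1$. Let $\varphi \in \widehat{\mathrm{Diff}}(\mathbb{R}^n,0)$ (resp. $\varphi\in\widehat{\mathrm{Diff}}(\mathbb{C}^n,0)$). Let $X_1$ be a linear vector field in $\mathcal X(\mathbb{R}^n,0)$ (resp. $\mathcal X(\mathbb{C}^n,0)$) such that its semisimple part $X_{1,s}$ is diagonal and $j^1\varphi = \exp(X_1)$. Then the following are equivalent: (i) there exists a formal vector field $X \in \hat{\mathcal X}(\mathbb{R}^n,0)$ (resp. $X\in \hat{\mathcal X}(\mathbb{C}^n,0)$) with $j^1 X = X_1$ and $\varphi = \exp(X)$; (ii) there exists $\eta \in \widehat{\mathrm{Diff}}(\mathbb{R}^n,0)$ (resp. $\eta\in\widehat{\mathrm{Diff}}(\mathbb{C}^n,0)$), tangent to the identity (i.e. $j^1\eta = \mathrm{Id}$), such that $\eta^{-1}\circ\varphi\circ\eta$ is strongly resonant with respect to $X_{1,s}$.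
   Context: Formal objects. Let $\mathfrak m$ be the maximal ideal of $\mathbb{C}[[z_1,\dots,z_n]]$. $\hat{\mathcal X}(\mathbb{C}^n,0)$ is the set of formal vector fields $\sum_j a_j\,\partial/\partial z_j$ with $a_j\in\mathfrak m$; $\hat{\mathcal X}(\mathbb{R}^n,0)$ is the subset of those whose power series $a_j$ have real coefficients; $\mathcal X(\mathbb{C}^n,0)$ and $\mathcal X(\mathbb{R}^n,0)$ are the corresponding subsets with convergent $a_j$. $\widehat{\mathrm{Diff}}(\mathbb{C}^n,0)$ is the group of formal diffeomorphisms $(\varphi_1,\dots,\varphi_n)$, $\varphi_j\in\mathfrak m$, with invertible linear part; $\widehat{\mathrm{Diff}}(\mathbb{R}^n,0)$ is the subgroup of those with real coefficients. $j^1$ denotes the first jet (linear part). $\exp(X)$ is the formal diffeomorphism with components $\sum_{j\ge0}X^{\circ j}(z_k)/j!$, $1\le k\le n$, where $X$ acts as a derivation. Linear part. A linear vector field $X_1=\sum_j (Bz)_j\,\partial/\partial z_j$ is identified with its matrix $B$; $X_1=X_{1,s}+X_{1,N}$ is its additive Jordan decomposition ($X_{1,s}$ semisimple, $X_{1,N}$ nilpotent, commuting), and $\exp(X_1)$ is the linear map $e^{B}$. Diagonal, and the coordinates $w$. In the complex case, $X_{1,s}$ diagonal means that its matrix in the coordinates $z$ is diagonal, and one puts $w=z$. In the real case, $X_{1,s}$ diagonal means that its matrix is in real Jordan normal form, i.e. block diagonal with blocks $(\beta)$, $\beta\in\mathbb{R}$, and $\begin{pmatrix}\lambda&-\mu\\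 \mu&\lambda\end{pmatrix}$, $\lambda,\mu\in\mathbb{R}$; then one introduces complex linear coordinates $(w_1,\dots,w_n)$ by $w_q=z_q$ for a $1\times1$ block in the coordinate $z_q$, and $z_p=w_p+w_{p+1}$, $z_{p+1}=-i w_p+i w_{p+1}$ for a $2\times2$ block in the coordinates $(z_p,z_{p+1})$. In either case $X_{1,s}=\sum_{k=1}^n\gamma_k w_k\,\partial/\partial w_k$ for some $\gamma_1,\dots,\gamma_n\in\mathbb{C}$. Strong resonance. A monomial $\lambda w_1^{a_1}\cdots w_n^{a_n}e_j$ ($e_j$ the $j$-th canonical basis vector, $a_k\in\mathbb{Z}_{\ge0}$) is strongly resonant (with respect to $X_{1,s}$) if $\gamma_j=\sum_{k=1}^n a_k\gamma_k$. A formal diffeomorphism is strongly resonant if, when it is expressed in the coordinates $w$ (i.e. conjugated by the linear change of coordinates), all its monomials with non-zero coefficient, including the linear ones, are strongly resonant. *)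

(* Defs.v *)
From mathcomp Require Import all_boot all_order all_algebra.
From mathcomp Require Import all_classical all_reals all_analysis.
From mathcomp Require Import complex.

Set Implicit Arguments.
Unset Strict Implicit.
Unset Printing Implicit Defensive.
Import Order.TTheory GRing.Theory Num.Theory.
Import numFieldNormedType.Exports.

Local Open Scope classical_set_scope.
Local Open Scope ring_scope.

Definition mindex (n : nat) := {ffun 'I_n -> nat}.

Definition mdeg n (a : mindex n) : nat := (\sum_(i < n) a i)%N.

Definition mdelta n (j : 'I_n) : mindex n := [ffun i => (i == j) : nat].

Definition mval n d (b : {ffun 'I_n -> 'I_d}) : mindex n :=
  [ffun i => val (b i)].

Section FormalSeries.
Variables (K : fieldType) (n : nat).

(* A formal power series is the family of its coefficients: f a is the
   coefficient of z^a. *)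
Definition fps := mindex n -> K.

Definition fps_one : fps := fun a => (a == 0)%:R.

Definition fps_var (j : 'I_n) : fps := fun a => (a == mdelta j)%:R.

(* The index b ranges over all multi-indices below a: the bound on its entries
   by |a| only serves to make the sum finite. *)
Definition fps_mul (f g : fps) : fps := fun a =>
  \sum_(b : {ffun 'I_n -> 'I_(mdeg a).+1} | [forall i, (b i <= a i)%N])
    f (mval b) * g [ffun i => (a i - b i)%N].

Definition fps_exp (f : fps) (k : nat) : fps := iter k (fps_mul f) fps_one.

Definition fps_deriv (j : 'I_n) (f : fps) : fps := fun a =>
  (a j).+1%:R * f (a + mdelta j).

(* An n-tuple of formal series: the components of a formal self-map of (K^n, 0),
   or the coefficients of a formal vector field. *)
Definition formal_map := 'I_n -> fps.

Definition formal_map_pow (eta : formal_map) (b : mindex n) : fps :=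
  \big[fps_mul/fps_one]_(j < n) fps_exp (eta j) (b j).

(* The composite f o eta; only meaningful when every eta j has no constant
   term.  Then eta^b has order at least |b|, so that the coefficient of z^a
   only involves the b with |b| <= |a|, all of which are in the range. *)
Definition fps_comp (f : fps) (eta : formal_map) : fps := fun a =>
  \sum_(b : {ffun 'I_n -> 'I_(mdeg a).+1})
    f (mval b) * formal_map_pow eta (mval b) a.

Definition formal_map_comp (phi eta : formal_map) : formal_map := fun j =>
  fps_comp (phi j) eta.

Definition formal_map_id : formal_map := fps_var.

Definition linear_formal_map (A : 'M[K]_n) : formal_map := fun j a =>
  \sum_(k < n) A j k * fps_var k a.

Definition in_maximal_ideal (f : fps) : Prop := f 0 = 0.

(* The matrix of the first jet of a tuple without constant terms. *)
Definition jet1 (phi : formal_map) : 'M[K]_n := \matrix_(j, k) phi j (mdelta k).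

Definition formal_vfield (X : formal_map) : Prop :=
  forall j, in_maximal_ideal (X j).

Definition formal_diffeo (phi : formal_map) : Prop :=
  (forall j, in_maximal_ideal (phi j)) /\ jet1 phi \in unitmx.

Definition formal_map_inverse (eta psi : formal_map) : Prop :=
  formal_map_comp eta psi = formal_map_id /\
  formal_map_comp psi eta = formal_map_id.

Definition vfield_act (X : formal_map) (f : fps) : fps := fun a =>
  \sum_(j < n) fps_mul (X j) (fps_deriv j f) a.

(* The map phi read in the linear coordinates w given by z = P w. *)
Definition in_coordinates (P : 'M[K]_n) (phi : formal_map) : formal_map :=
  formal_map_comp (linear_formal_map (invmx P))
    (formal_map_comp phi (linear_formal_map P)).

Definition strongly_resonant (gamma : 'I_n -> K) (phi : formal_map) : Prop :=
  forall (j : 'I_n) (a : mindex n), phi j a != 0 ->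
    gamma j = \sum_(k < n) (a k)%:R * gamma k.

Definition nilpotent_mx (N : 'M[K]_n) : Prop := exists k : nat, N ^+ k = 0.

End FormalSeries.

Arguments fps_one {K n}.
Arguments fps_var {K n} j.
Arguments formal_map_id {K n}.

Section RealOrComplex.
Variables (R : realType) (n : nat).
Local Notation C := (R[i]).

(* B = S + N is the additive Jordan decomposition of B.  A real matrix is
   semisimple over the reals if and only if it is diagonalizable over the
   complex numbers, so that this serves for real matrices too. *)
Definition jordan_decomposition (B S N : 'M[C]_n) : Prop :=
  [/\ B = S + N, diagonalizable S, nilpotent_mx N & S *m N = N *m S].

(* C^o carries the topology of the complex modulus. *)
Definition is_expmx (B E : 'M[C]_n) : Prop :=
  forall i j : 'I_n,
    series (fun m => (B ^+ m) i j / m`!%:R : C^o) @ \oo --> (E i j : C^o).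

(* phi = exp(X).  When the linear part of X is not nilpotent the coefficients
   of exp(X) are genuinely infinite sums, which converge in C. *)
Definition is_exp_vfield (X phi : formal_map C n) : Prop :=
  forall (k : 'I_n) (a : mindex n),
    series (fun m => iter m (vfield_act X) (fps_var k) a / m`!%:R : C^o) @ \oo
      --> (phi k a : C^o).

Definition real_mx (B : 'M[C]_n) : Prop :=
  forall i j, B i j \is Num.real.

Definition real_formal_map (phi : formal_map C n) : Prop :=
  forall (j : 'I_n) (a : mindex n), phi j a \is Num.real.

Definition real_vfield (X : formal_map C n) : Prop :=
  formal_vfield X /\ real_formal_map X.

Definition real_diffeo (phi : formal_map C n) : Prop :=
  formal_diffeo phi /\ real_formal_map phi.

(* A partition of the coordinates into consecutive blocks of size 1 or 2 is
   given by the set D of the first indices of the blocks of size 2. *)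
Definition block_structure (D : {set 'I_n}) : Prop :=
  forall p, p \in D -> exists2 q : 'I_n, q = p.+1 :> nat & q \notin D.

Definition block2 (D : {set 'I_n}) (p q : 'I_n) : bool :=
  (p \in D) && (q == p.+1 :> nat).

Definition real_jordan_form (D : {set 'I_n}) (S : 'M[C]_n) : Prop :=
  [/\ real_mx S,
      forall p q, block2 D p q -> S q q = S p p /\ S p q = - S q p
    & forall i j, i != j -> ~~ block2 D i j -> ~~ block2 D j i -> S i j = 0].

(* The matrix W of the change of coordinates z = W w, that is, z_q = w_q for a
   block {q}, and z_p = w_p + w_q, z_q = - i w_p + i w_q for a block {p, q},
   q = p + 1. *)
Definition w_coordinates (D : {set 'I_n}) : 'M[C]_n :=
  \matrix_(i, k)
    if i == k then (if [exists p, block2 D p i] then 'i%C else 1)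
    else if block2 D i k then 1
    else if block2 D k i then - 'i%C
    else 0.

(* The gamma_k of S = \sum_k gamma_k w_k d/dw_k: in the coordinates w the matrix
   of S, a real Jordan form with blocks D, is diagonal. *)
Definition w_eigenvalues (D : {set 'I_n}) (S : 'M[C]_n) (k : 'I_n) : C :=
  (invmx (w_coordinates D) *m S *m w_coordinates D) k k.

End RealOrComplex.

(* Main.v *)
(* A vector field X with linear part S + N acts on power series as a derivation
   preserving the powers of the maximal ideal, and f |-> f o exp(X) is the
   coefficientwise sum of X^m f / m!.

   (i) => (ii).  On every jet space, X has generalized eigenspaces, and the
   product of two of them lies in the one of the sum of the eigenvalues.  In
   coordinates w diagonalizing S, correcting w_j degree by degree produces a
   coordinate theta_j tangent to w_j which is a generalized eigenvector of X
   for gamma_j on every jet space.  As exp(X) commutes with X, theta_j o exp(X)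
   is again such a generalized eigenvector, hence a series in the theta^a of
   weight gamma_j: in the coordinates theta, exp(X) is strongly resonant.  The
   condition on theta is linear with real coefficients, so that in the real
   case the real part of theta will do.

   (ii) => (i).  If chi = eta^-1 o phi o eta is strongly resonant, it commutes
   with the derivation S.  Dividing by e^S = e^B e^-N leaves a map u with
   unipotent linear part e^N, whose logarithm Z is a derivation commuting with
   S and with linear part N.  Thus chi = exp(S + Z), and S + Z is conjugated
   back by eta. *)

From HB Require Import structures.
Require Import Defs.
From mathcomp Require Import all_boot all_order all_algebra.
From mathcomp Require Import all_classical all_reals all_analysis.
From mathcomp Require Import complex ring.
Import Order.TTheory GRing.Theory Num.Theory.
Import numFieldNormedType.Exports.
Local Open Scope ring_scope.
Set Implicit Arguments.
Unset Strict Implicit.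
Unset Printing Implicit Defensive.

(** * Formal power series *)

(** What strong resonance adds to resonance is the choice of the logarithm. Equality of e^(gamma_j)
    and e^(sum a_k gamma_k) would only make chi commute with e^S; equality of the exponents makes it
    commute with S. This allows S to be split off, so that the linear part obtained is the
    prescribed X_1 and not merely some logarithm of j^1 phi. Only the unipotent factor is given a
    logarithm, by algebra alone; convergence enters through the semisimple part. An operator that
    does not lower the order acts on each jet space as a finite matrix, so the exponential series
    are dominated by real ones, which justifies the Cauchy products behind the multiplicativity of
    exp(X) and behind e^(Z + S) = e^Z e^S. No jet space is formed: statements on jets are made for
    series modulo order k, and operators are handled through their values on monomials. The real
    case is carried inside C, because the w are complex even when phi is real. Reality must be
    achieved for theta in the coordinates z, where the eigenvector equations are coupled by S but
    have real coefficients. *)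

Section Multiindices.
Variable n : nat.
Implicit Types a b c : mindex n.

(** A finite range containing every multi-index of degree at most N. One box can serve all the
    factors of a product, unlike the ranges of [fps_mul] and [fps_comp], which vary with the
    coefficient. *)
Definition box N := {ffun 'I_n -> 'I_N.+1}.

(** Inverse of [mval] on the multi-indices inside the box; [inord] sends an entry beyond N to 0. *)
Definition mbox N b : box N := [ffun i => inord (b i)].

Lemma mdegD a b : mdeg (a + b) = (mdeg a + mdeg b)%N.
Proof. by rewrite /mdeg -big_split; apply: eq_bigr => i _; rewrite !ffunE. Qed.

Lemma mdeg0 : mdeg (0 : mindex n) = 0%N.
Proof. by rewrite /mdeg big1 // => i _; rewrite ffunE. Qed.

Lemma mdeg_eq0 a : mdeg a = 0%N -> a = 0.
Proof.
move=> a0; apply/ffunP => i; rewrite ffunE; apply/eqP.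
by move/eqP: a0; rewrite /mdeg sum_nat_eq0 => /forallP/(_ i).
Qed.

Lemma mdeg_delta (j : 'I_n) : mdeg (mdelta j) = 1%N.
Proof.
rewrite /mdeg (bigD1 j) //= big1 ?ffunE ?eqxx // => i ij.
by rewrite ffunE (negbTE ij).
Qed.

Lemma mdeg_ge a i : (a i <= mdeg a)%N.
Proof. by rewrite /mdeg (bigD1 i) //= leq_addr. Qed.

Lemma mdeg_addl a b c : b + c = a -> (mdeg b <= mdeg a)%N.
Proof. by move=> <-; rewrite mdegD leq_addr. Qed.

Lemma mdeg_addr a b c : b + c = a -> (mdeg c <= mdeg a)%N.
Proof. by move=> <-; rewrite mdegD leq_addl. Qed.

Lemma mindex_addI a : injective (+%R a).
Proof.
move=> b c e; apply/ffunP => i; apply: (@addnI (a i)).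
by move/ffunP/(_ i): e; rewrite !ffunE.
Qed.

Lemma mindex_neq0 a : a != 0 -> exists (j : 'I_n) b, a = mdelta j + b.
Proof.
move=> a0; have [i ai] : exists i, a i != 0%N.
  apply/existsP; apply: contraR a0; rewrite negb_exists => /forallP h.
  by apply/eqP/ffunP => i; rewrite ffunE; have := h i; rewrite negbK => /eqP.
exists i, [ffun k => a k - (k == i)]%N; apply/ffunP => k; rewrite !ffunE.
case: eqP => [->|_]; last by rewrite subn0 add0r.
by rewrite [RHS]subnKC // lt0n.
Qed.

Lemma mindex_ind (P : mindex n -> Prop) : P 0 ->
  (forall j b, P b -> P (mdelta j + b)) -> forall b, P b.
Proof.
move=> P0 PD b; elim: {b}(mdeg b) {-2}b (erefl (mdeg b)) => [|k IH] b bk.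
  by rewrite (mdeg_eq0 bk).
have /mindex_neq0 [j [c bc]] : b != 0 by apply: contra_eq_neq bk => ->; rewrite mdeg0.
by rewrite bc; apply/PD/IH; move: bk; rewrite bc mdegD mdeg_delta => -[].
Qed.

Lemma mdeg1_delta a : mdeg a = 1%N -> exists j, a = mdelta j.
Proof.
move=> a1; have /mindex_neq0 [j [b ab]] : a != 0.
  by apply: contra_eq_neq a1 => ->; rewrite mdeg0.
exists j; rewrite ab; move: a1; rewrite ab mdegD mdeg_delta => -[] /mdeg_eq0 ->.
by rewrite addr0.
Qed.

Lemma mvalK N : cancel (@mval n N.+1) (@mbox N).
Proof. by move=> b; apply/ffunP => i; rewrite !ffunE inord_val. Qed.

Lemma mboxK N b : (forall i, b i <= N)%N -> mval (mbox N b) = b.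
Proof. by move=> h; apply/ffunP => i; rewrite !ffunE /= inordK // ltnS. Qed.

Lemma mboxK_deg N b : (mdeg b <= N)%N -> mval (mbox N b) = b.
Proof. by move=> h; apply: mboxK => i; apply: leq_trans (mdeg_ge _ _) h. Qed.

Lemma sum_box_eq (V : nmodType) N (F : mindex n -> V) b : (forall i, b i <= N)%N ->
  \sum_(c : box N | mval c == b) F (mval c) = F b.
Proof.
move=> h; rewrite (bigD1 (mbox N b)) ?mboxK //= big1 ?addr0 // => c /andP [/eqP cb].
by rewrite -cb mvalK eqxx.
Qed.

Lemma sum_box_le (V : nmodType) N a (F : mindex n -> V) : (mdeg a <= N)%N ->
  \sum_(b : {ffun 'I_n -> 'I_(mdeg a).+1} | [forall i, (b i <= a i)%N]) F (mval b)
  = \sum_(b : box N | [forall i, (b i <= a i)%N]) F (mval b).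
Proof.
move=> aN; rewrite (reindex_onto (fun b : box N => mbox (mdeg a) (mval b))
  (fun b : box (mdeg a) => mbox N (mval b))) /=.
  have le_a (b : box N) i : (b i <= a i -> b i <= mdeg a)%N.
    by move=> h; apply: leq_trans h (mdeg_ge _ _).
  apply: eq_big => [b|b].
    apply/andP/forallP => [[/forallP h /eqP e] i|h]; last first.
      have e : mval (mbox (mdeg a) (mval b)) = mval b.
        by apply: mboxK => i; rewrite ffunE le_a.
      split; last by rewrite e mvalK.
      apply/forallP => i; have /ffunP/(_ i) := e; rewrite !ffunE => /= ->; exact: h.
    set c := mbox _ _ in h e; have -> : b i = c i :> nat; last exact: h.
    rewrite -e ffunE /= ffunE inordK // ltnS; exact: leq_trans (leq_ord _) aN.
  move=> /andP [_ /eqP]; set c := mbox (mdeg a) _; clearbody c => <-; rewrite mboxK // => i.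
  by rewrite ffunE; apply: leq_trans aN; rewrite -ltnS; apply: ltn_ord.
move=> b /forallP h; rewrite [mval (mbox N _)]mboxK ?mvalK // => i; rewrite ffunE.
by apply: leq_trans aN; rewrite -ltnS; apply: ltn_ord.
Qed.

End Multiindices.

Section Algebra.
Variables (K : fieldType) (n : nat).
Implicit Types (f g h : fps K n) (a b c : mindex n).

HB.instance Definition _ := gen_eqMixin (fps K n).
HB.instance Definition _ := gen_choiceMixin (fps K n).

Lemma fps_addA : associative (fun f g => (fun a => f a + g a) : fps K n).
Proof. by move=> f g h; apply/funext => a; rewrite addrA. Qed.
Lemma fps_addC : commutative (fun f g => (fun a => f a + g a) : fps K n).
Proof. by move=> f g; apply/funext => a; rewrite addrC. Qed.
Lemma fps_add0 : left_id ((fun=> 0) : fps K n) (fun f g => (fun a => f a + g a) : fps K n).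
Proof. by move=> f; apply/funext => a; rewrite add0r. Qed.
Lemma fps_addN : left_inverse ((fun=> 0) : fps K n) (fun f => (fun a => - f a) : fps K n)
  (fun f g => (fun a => f a + g a) : fps K n).
Proof. by move=> f; apply/funext => a; rewrite addNr. Qed.

HB.instance Definition _ := GRing.isZmodule.Build (fps K n)
  fps_addA fps_addC fps_add0 fps_addN.

Lemma coefD f g a : (f + g) a = f a + g a. Proof. by []. Qed.
Lemma coefN f a : (- f) a = - f a. Proof. by []. Qed.
Lemma coefB f g a : (f - g) a = f a - g a. Proof. by []. Qed.
Lemma coef0 a : (0 : fps K n) a = 0. Proof. by []. Qed.
Lemma coef_sum I (r : seq I) (P : pred I) (F : I -> fps K n) a :
  (\sum_(i <- r | P i) F i) a = \sum_(i <- r | P i) F i a.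
Proof. by elim/big_rec2: _ => // i x y _ <-. Qed.

(** The symmetric form of the product, in any box that is large enough: the ring axioms become
    exchanges of sums. *)
Lemma fps_mulE N f g a : (mdeg a <= N)%N -> fps_mul f g a =
  \sum_(b : box n N) \sum_(c : box n N | mval b + mval c == a) f (mval b) * g (mval c).
Proof.
move=> aN; rewrite /fps_mul.
pose F (b : mindex n) := f b * g [ffun i => (a i - b i)%N].
transitivity (\sum_(b : {ffun 'I_n -> 'I_(mdeg a).+1} | [forall i, (b i <= a i)%N]) F (mval b)).
  apply: eq_bigr => b _; congr (_ * g _); apply/ffunP => i; rewrite !ffunE //.
rewrite (sum_box_le F aN) big_mkcond /=; apply: eq_bigr => b _.
case: ifPn => [/forallP h|/forallP h]; last first.
  rewrite big1 // => c /eqP bca; case: h => i; rewrite -bca !ffunE; exact: leq_addr.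
transitivity (\sum_(c : box n N | mval c == [ffun i => (a i - b i)%N]) f (mval b) * g (mval c)).
  rewrite (sum_box_eq (fun c => f (mval b) * g c)) ?/F.
    by congr (_ * g _); apply/ffunP => i; rewrite !ffunE.
  move=> i; rewrite ffunE; apply: leq_trans (leq_subr _ _) (leq_trans (mdeg_ge _ _) aN).
apply: eq_bigl => c; apply/eqP/eqP => [->|<-].
  by apply/ffunP => i; rewrite !ffunE; apply: (subnKC (h i)).
by apply/ffunP => i; rewrite !ffunE; apply: esym (addKn _ _).
Qed.

Lemma fps_mulC : commutative (@fps_mul K n).
Proof.
move=> f g; apply/funext => a; rewrite !(fps_mulE _ _ (leqnn _)).
rewrite (exchange_big_dep xpredT) //=; apply: eq_bigr => b _.
by apply: eq_big => c; rewrite 1?addrC // => _; rewrite mulrC.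
Qed.

Lemma fps_mulDl : left_distributive (@fps_mul K n) +%R.
Proof.
move=> f g h; apply/funext => a; rewrite coefD /fps_mul -big_split /=.
by apply: eq_bigr => b _; rewrite mulrDl.
Qed.

Lemma fps_mul1 : left_id (@fps_one K n) (@fps_mul K n).
Proof.
move=> f; apply/funext => a; rewrite /fps_mul (bigD1 (mbox _ 0)) /=; last first.
  by apply/forallP => i; rewrite !ffunE inordK.
rewrite big1 ?addr0 => [|b /andP [_ b0]]; last first.
  rewrite /fps_one; case: eqP => [e|]; last by rewrite mul0r.
  by case/eqP: b0; rewrite -(mvalK b) e.
rewrite mboxK => [|i]; last by rewrite ffunE.
rewrite /fps_one eqxx mul1r; congr f; apply/ffunP => i; rewrite !ffunE inordK ?subn0 //.
Qed.

(** Both sides are brought to the sum over the triples with b + (c + d) = a, in one box for all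
    three indices. *)
Lemma fps_mulA : associative (@fps_mul K n).
Proof.
move=> f g h; apply/funext => a; pose N := mdeg a.
have le_N b c : b + c = a -> (forall i, b i <= N)%N.
  by move=> /mdeg_addl e i; apply: leq_trans e; apply: mdeg_ge.
transitivity (\sum_(b : box n N) \sum_(c : box n N) \sum_(d : box n N | mval b + (mval c + mval d) == a)
   f (mval b) * (g (mval c) * h (mval d))).
  rewrite (@fps_mulE N) //; apply: eq_bigr => b _.
  transitivity (\sum_(e : box n N | mval b + mval e == a)
     \sum_(c : box n N) \sum_(d : box n N | mval e == mval c + mval d)
        f (mval b) * (g (mval c) * h (mval d))).
    apply: eq_bigr => e /eqP bea; rewrite (@fps_mulE N); last exact: mdeg_addr bea.
    rewrite mulr_sumr; apply: eq_bigr => c _; rewrite mulr_sumr; apply: eq_bigl => d.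
    by rewrite eq_sym.
  rewrite exchange_big /=; apply: eq_bigr => c _.
  rewrite (exchange_big_dep (fun d : box n N => mval b + (mval c + mval d) == a)) /=; last first.
    by move=> e d bea /eqP <-.
  apply: eq_bigr => d /eqP bcda.
  rewrite (eq_bigl (fun e : box n N => mval e == mval c + mval d)); last first.
    by move=> e; rewrite andb_idl // => /eqP ->; rewrite bcda.
  rewrite (sum_box_eq (fun _ => _)) //; apply: (le_N _ (mval b)); by rewrite addrC.
rewrite (@fps_mulE N) //.
transitivity (\sum_(e : box n N) \sum_(d : box n N | mval e + mval d == a)
     \sum_(b : box n N) \sum_(c : box n N | mval e == mval b + mval c)
        f (mval b) * (g (mval c) * h (mval d))); last first.
  apply: eq_bigr => e _; apply: eq_bigr => d /eqP eda.
  rewrite (@fps_mulE N); last exact: mdeg_addl eda.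
  rewrite mulr_suml; apply: eq_bigr => b _; rewrite mulr_suml.
  by apply: eq_big => [c|c _]; rewrite 1?eq_sym // mulrA.
under [RHS]eq_bigr => e _ do rewrite exchange_big /=.
rewrite [RHS]exchange_big /=; apply: eq_bigr => b _.
under [RHS]eq_bigr => e _ do rewrite (exchange_big_dep xpredT) //=.
rewrite [RHS]exchange_big /=; apply: eq_bigr => c _.
rewrite [RHS](exchange_big_dep (fun d : box n N => mval b + (mval c + mval d) == a)) /=; last first.
  by move=> e d _; rewrite addrA => /andP [eda /eqP <-].
apply: eq_bigr => d /eqP bcda.
rewrite (eq_bigl (fun e : box n N => mval e == mval b + mval c)); last first.
  by move=> e; apply: andb_idl => /eqP ->; rewrite -addrA bcda.
rewrite (sum_box_eq (fun _ => _)) //; apply: (le_N _ (mval d)); by rewrite -addrA.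
Qed.

Lemma fps_one_neq0 : fps_one != 0 :> fps K n.
Proof. by apply/eqP => /(congr1 (fun f : fps K n => f 0)) /eqP; rewrite /fps_one eqxx oner_eq0. Qed.

HB.instance Definition _ := GRing.Zmodule_isComNzRing.Build (fps K n)
  fps_mulA fps_mulC fps_mul1 fps_mulDl fps_one_neq0.

Definition fps_scale (x : K) f : fps K n := fun a => x * f a.
Lemma fps_scaleA x y f : fps_scale x (fps_scale y f) = fps_scale (x * y) f.
Proof. by apply/funext => a; rewrite /fps_scale mulrA. Qed.
Lemma fps_scale1 : left_id 1 fps_scale.
Proof. by move=> f; apply/funext => a; rewrite /fps_scale mul1r. Qed.
Lemma fps_scaleDr : right_distributive fps_scale +%R.
Proof. by move=> x f g; apply/funext => a; rewrite /fps_scale mulrDr. Qed.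
Lemma fps_scaleDl f : {morph fps_scale^~ f : x y / x + y}.
Proof. by move=> x y; apply/funext => a; rewrite /fps_scale mulrDl. Qed.

HB.instance Definition _ := GRing.Zmodule_isLmodule.Build K (fps K n)
  fps_scaleA fps_scale1 fps_scaleDr fps_scaleDl.

Lemma coefZ x f a : (x *: f) a = x * f a. Proof. by []. Qed.
Lemma coef1 a : (1 : fps K n) a = (a == 0)%:R. Proof. by []. Qed.

Lemma fps_scaleAl x f g : x *: (f * g) = x *: f * g.
Proof.
apply/funext => a; rewrite /GRing.mul /= /fps_mul coefZ mulr_sumr.
by apply: eq_bigr => b _; rewrite mulrA.
Qed.

HB.instance Definition _ := GRing.Lmodule_isLalgebra.Build K (fps K n) fps_scaleAl.
HB.instance Definition _ := GRing.Lalgebra_isComAlgebra.Build K (fps K n).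

Lemma fps_coefM N f g a : (mdeg a <= N)%N -> (f * g) a =
  \sum_(b : box n N) \sum_(c : box n N | mval b + mval c == a) f (mval b) * g (mval c).
Proof. exact: fps_mulE. Qed.

Lemma fps_expE f k : fps_exp f k = f ^+ k.
Proof. by elim: k => [|k IH] //; rewrite exprS /fps_exp /= -/(fps_exp f k) IH. Qed.

Lemma formal_map_powE (eta : formal_map K n) b :
  formal_map_pow eta b = \prod_(j < n) eta j ^+ b j.
Proof. by rewrite /formal_map_pow; apply: eq_bigr => j _; rewrite fps_expE. Qed.

End Algebra.

(** * Continuous linear operators: substitutions and derivations *)

Section Operators.
Variables (K : fieldType) (n : nat).
Implicit Types (f g h : fps K n) (a b c : mindex n) (L : fps K n -> fps K n).

Definition mon b : fps K n := fun a => (a == b)%:R.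

(** Membership in the k-th power of the maximal ideal; [ord k (f - g)] says that f and g have the
    same coefficients in all degrees below k. *)
Definition ord k f := forall a, (mdeg a < k)%N -> f a = 0.

Lemma ord0r f : ord 0 f. Proof. by []. Qed.

Lemma ord_zero k : ord k 0. Proof. by []. Qed.

Lemma ordD k f g : ord k f -> ord k g -> ord k (f + g).
Proof. by move=> hf hg a ak; rewrite coefD hf // hg // addr0. Qed.

Lemma ordN k f : ord k f -> ord k (- f).
Proof. by move=> hf a ak; rewrite coefN hf // oppr0. Qed.

Lemma ordB k f g : ord k f -> ord k g -> ord k (f - g).
Proof. by move=> hf hg; apply: ordD => //; apply: ordN. Qed.

Lemma ordZ k x f : ord k f -> ord k (x *: f).
Proof. by move=> hf a ak; rewrite coefZ hf // mulr0. Qed.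

Lemma ord_sum k I (r : seq I) (P : pred I) (F : I -> fps K n) :
  (forall i, P i -> ord k (F i)) -> ord k (\sum_(i <- r | P i) F i).
Proof. by move=> h; elim/big_ind: _ => //; apply: ordD. Qed.

Lemma ord_le k l f : (l <= k)%N -> ord k f -> ord l f.
Proof. by move=> lk hf a al; apply: hf; apply: leq_trans lk. Qed.

Lemma ordM k l f g : ord k f -> ord l g -> ord (k + l) (f * g).
Proof.
move=> hf hg a akl; rewrite (fps_coefM _ _ (leqnn _)) big1 // => b _.
rewrite big1 // => c /eqP bca; have [bk|kb] := ltnP (mdeg (mval b)) k.
  by rewrite hf // mul0r.
rewrite hg ?mulr0 //; rewrite -bca mdegD in akl.
by rewrite -(ltn_add2l k) (leq_ltn_trans _ akl) // leq_add2r.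
Qed.

Lemma ordMl k f g : ord k f -> ord k (f * g).
Proof. by move=> hf; rewrite -[k]addn0; apply: ordM. Qed.

Lemma ordMr k f g : ord k g -> ord k (f * g).
Proof. by move=> hf; rewrite -[k]add0n; apply: ordM. Qed.

Lemma ordX k f : ord 1 f -> ord k (f ^+ k).
Proof. by move=> hf; elim: k => // k IH; rewrite exprS -add1n; apply: ordM. Qed.

Lemma ord_prod I (r : seq I) (F : I -> fps K n) (d : I -> nat) :
  (forall i, ord (d i) (F i)) -> ord (\sum_(i <- r) d i) (\prod_(i <- r) F i).
Proof. by move=> h; elim/big_rec2: _ => // i y x _ IH; apply: ordM. Qed.

Lemma ord_eq0 f : (forall k, ord k f) -> f = 0.
Proof. by move=> h; apply/funext => a; apply: (h (mdeg a).+1). Qed.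

Lemma ord_eq k f g a : ord k (f - g) -> (mdeg a < k)%N -> f a = g a.
Proof. by move=> h /h; rewrite coefB => /subr0_eq. Qed.

Lemma ord_mon b : ord (mdeg b) (mon b).
Proof. by move=> a; rewrite /mon; case: eqP => // ->; rewrite ltnn. Qed.

Lemma ord_var (j : 'I_n) : ord 1 (fps_var j).
Proof. by move=> a; rewrite /fps_var; case: eqP => // ->; rewrite mdeg_delta. Qed.

Lemma ord1P f : ord 1 f <-> in_maximal_ideal f.
Proof.
split=> [h|h a]; first by apply: h; rewrite mdeg0.
by rewrite ltnS leqn0 => /eqP/mdeg_eq0 ->.
Qed.

Lemma ord_mdelta f : ord 1 f -> (forall k, f (mdelta k) = 0) -> ord 2 f.
Proof.
move=> f1 h a; rewrite ltnS leq_eqVlt => /predU1P [/mdeg1_delta [j ->] //|].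
exact: f1.
Qed.

Lemma coef_mul_mon b f a : (mon b * f) (b + a) = f a.
Proof.
rewrite (fps_coefM _ _ (leqnn _)).
rewrite (bigD1 (mbox _ b)) //= mboxK_deg ?mdegD ?leq_addr //.
rewrite [X in _ + X = _]big1 ?addr0 => [|c cb]; last first.
  rewrite big1 // => d _; rewrite /mon; case: eqP => [e|]; last by rewrite mul0r.
  by case/eqP: cb; rewrite -(mvalK c) e.
under eq_bigr do rewrite {1}/mon eqxx mul1r.
rewrite (eq_bigl (fun d => mval d == a)); last by move=> d; rewrite (inj_eq (@mindex_addI _ b)).
by rewrite sum_box_eq // => i; rewrite (leq_trans (mdeg_ge _ _)) // leq_addl.
Qed.

Lemma monM b c : mon (b + c) = mon b * mon c.
Proof.
apply/funext => a; rewrite (fps_coefM _ _ (leqnn _)).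
under eq_bigr => b' _ do under eq_bigr => c' _ do rewrite /mon -natrM mulnb.
have [ea|/eqP ea] := eqVneq a (b + c); last first.
  rewrite /mon; case: eqP => // _; rewrite big1 // => b' _; rewrite big1 // => c' /eqP e.
  by case: eqP => // eb; case: eqP => // ec; case: ea; rewrite -e eb ec.
have bN : (mdeg b <= mdeg a)%N by rewrite ea mdegD leq_addr.
have cN : (mdeg c <= mdeg a)%N by rewrite ea mdegD leq_addl.
rewrite (bigD1 (mbox _ b)) //= (bigD1 (mbox _ c)) ?mboxK_deg //= -?ea //.
rewrite !eqxx [X in _ + X + _]big1 ?[X in _ + X]big1 ?addr0 /mon ?ea ?eqxx // => [b' eb|c' /andP [_ ec]].
  rewrite big1 // => c' _; case: eqP => // e; case/eqP: eb; by rewrite -(mvalK b') e.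
case: (mval c' =P c) => // e; case/eqP: ec; by rewrite -(mvalK c') e.
Qed.

Lemma mon0 : mon 0 = 1. Proof. by []. Qed.

Lemma mon_delta j : mon (mdelta j) = fps_var j. Proof. by []. Qed.

Lemma var_mulI j f g : fps_var j * f = fps_var j * g -> f = g.
Proof.
move=> e; apply/funext => a.
by rewrite -(coef_mul_mon (mdelta j) f) -(coef_mul_mon (mdelta j) g) mon_delta e.
Qed.

Lemma ord_trunc N f : ord N.+1 (f - \sum_(b : box n N) f (mval b) *: mon (mval b)).
Proof.
move=> a aN; rewrite coefB coef_sum.
under eq_bigr do rewrite coefZ /mon.
rewrite (bigD1 (mbox _ a)) //= mboxK_deg // eqxx mulr1 big1 ?addr0 ?subrr // => b ba.
case: eqP => [e|]; last by rewrite mulr0.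
by case/eqP: ba; rewrite e mvalK.
Qed.

(* Continuity for the m-adic topology is what lets such an operator be
   determined by its values on monomials. *)
Record flin L : Prop := Flin {
  flinP : forall x f g, L (x *: f + g) = x *: L f + L g;
  flin_ord : forall k f, ord k f -> ord k (L f) }.

Section FlinTheory.
Variables (L : fps K n -> fps K n) (hL : flin L).

Lemma flin0 : L 0 = 0.
Proof. by apply: ord_eq0 => k; apply: flin_ord. Qed.

Lemma flinD f g : L (f + g) = L f + L g.
Proof. by rewrite -[f]scale1r flinP // !scale1r. Qed.

Lemma flinZ x f : L (x *: f) = x *: L f.
Proof. by rewrite -[x *: f]addr0 flinP // flin0 addr0. Qed.

Lemma flinN f : L (- f) = - L f.
Proof. by rewrite -scaleN1r flinZ scaleN1r. Qed.

Lemma flinB f g : L (f - g) = L f - L g.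
Proof. by rewrite flinD flinN. Qed.

Lemma flin_sum I (r : seq I) (P : pred I) (F : I -> fps K n) :
  L (\sum_(i <- r | P i) F i) = \sum_(i <- r | P i) L (F i).
Proof. exact: (big_morph L flinD flin0). Qed.

(** The matrix of L in the monomials: by continuity the terms of f of degree above N do not reach
    z^a, so that only finite sums occur. *)
Lemma flin_coef N f a : (mdeg a <= N)%N ->
  L f a = \sum_(b : box n N) f (mval b) * L (mon (mval b)) a.
Proof.
move=> aN; have h := flin_ord hL (@ord_trunc N f).
rewrite flinB in h; rewrite (ord_eq h) // flin_sum coef_sum.
by apply: eq_bigr => b _; rewrite flinZ.
Qed.

End FlinTheory.

Lemma flin_id : flin id. Proof. by split. Qed.

Lemma flin_comp L1 L2 : flin L1 -> flin L2 -> flin (fun f => L1 (L2 f)).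
Proof. by move=> h1 h2; split=> [x f g|k f /(flin_ord h2)/(flin_ord h1)]; rewrite ?(flinP h2, flinP h1). Qed.

Lemma flin_iter L k : flin L -> flin (iter k L).
Proof. by move=> h; elim: k => [|k IH]; [apply: flin_id | apply: flin_comp h IH]. Qed.

Lemma flin_add L1 L2 : flin L1 -> flin L2 -> flin (fun f => L1 f + L2 f).
Proof.
move=> h1 h2; split=> [x f g|k f hf]; last by apply: ordD; apply: flin_ord.
by rewrite (flinP h1) (flinP h2) scalerDr addrACA.
Qed.

Lemma flin_scale x L : flin L -> flin (fun f => x *: L f).
Proof.
move=> h; split=> [y f g|k f hf]; last by apply: ordZ; apply: flin_ord.
by rewrite (flinP h) scalerDr !scalerA mulrC.
Qed.

Lemma flin_sub L x : flin L -> flin (fun f => L f - x *: f).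
Proof.
move=> h; split=> [y f g|k f hf]; last by apply: ordB; [apply: flin_ord | apply: ordZ].
by rewrite (flinP h) scalerBr scalerDr opprD addrACA !scalerA mulrC.
Qed.

Lemma flin_mul g : flin ( *%R g).
Proof. by split=> [x f h|k f]; [rewrite mulrDr scalerAr | apply: ordMr]. Qed.

Lemma flin_mulr L g : flin L -> flin (fun f => L f * g).
Proof.
move=> h; split=> [x f f'|k f hf]; last by apply: ordMl; apply: flin_ord.
by rewrite (flinP h) mulrDl scalerAl.
Qed.

Lemma flin_ext L1 L2 : flin L1 -> flin L2 -> (forall b, L1 (mon b) = L2 (mon b)) -> L1 =1 L2.
Proof.
move=> h1 h2 e f; apply/funext => a.
by rewrite !(flin_coef _ _ (leqnn _)) //; apply: eq_bigr => b _; rewrite e.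
Qed.

Definition fhom L := [/\ flin L, L 1 = 1 & forall f g, L (f * g) = L f * L g].

Lemma fhom_ext L1 L2 : fhom L1 -> fhom L2 ->
  (forall j, L1 (fps_var j) = L2 (fps_var j)) -> L1 =1 L2.
Proof.
move=> [h1 o1 m1] [h2 o2 m2] e; apply: flin_ext => //.
by apply: mindex_ind => [|j b IH]; rewrite ?mon0 ?o1 ?o2 // monM m1 m2 IH mon_delta e.
Qed.

Lemma fhom_id : fhom id. Proof. by split=> //; apply: flin_id. Qed.

Lemma fhom_comp L1 L2 : fhom L1 -> fhom L2 -> fhom (fun f => L1 (L2 f)).
Proof.
move=> [h1 o1 m1] [h2 o2 m2]; split=> [||f g]; first exact: flin_comp.
  by rewrite o2.
by rewrite m2.
Qed.

(** A derivation relative to an algebra endomorphism H. Ordinary derivations have H = id; the twist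
    makes H o L and L o H objects of the same kind, determined by their values on the variables. *)
Definition fder (H : fps K n -> fps K n) L :=
  flin L /\ forall f g, L (f * g) = L f * H g + H f * L g.

Lemma fder1 H L : fhom H -> fder H L -> L 1 = 0.
Proof.
move=> [_ h1 _] [_ /(_ 1 1)]; rewrite mulr1 h1 mulr1 mul1r => /eqP.
by rewrite -subr_eq0 opprD addrA subrr add0r oppr_eq0 => /eqP.
Qed.

Lemma fder_ext H L1 L2 : fhom H -> fder H L1 -> fder H L2 ->
  (forall j, L1 (fps_var j) = L2 (fps_var j)) -> L1 =1 L2.
Proof.
move=> hH d1 d2 e; apply: flin_ext; [exact: d1.1 | exact: d2.1 |].
apply: mindex_ind => [|j b IH]; first by rewrite mon0 (fder1 hH d1) (fder1 hH d2).
by rewrite monM d1.2 d2.2 IH mon_delta e.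
Qed.

(** Unlike d/dz_j, the operator z_j d/dz_j is diagonal on monomials. Identities for d/dz_j are
    therefore proved after multiplication by z_j, which [var_mulI] cancels. *)
Lemma coef_var_deriv j f a : (fps_var j * fps_deriv j f) a = (a j)%:R * f a.
Proof.
have [aj|aj] := eqVneq (a j) 0%N.
  rewrite aj mul0r (fps_coefM _ _ (leqnn _)) big1 // => b _; rewrite big1 // => c /eqP e.
  rewrite /fps_var; case: eqP => [eb|]; last by rewrite mul0r.
  by have /ffunP/(_ j) := e; rewrite eb !ffunE eqxx aj.
have [b e] : exists b, a = mdelta j + b.
  exists [ffun k => a k - (k == j)]%N; apply/ffunP => k; rewrite !ffunE.
  case: eqP => [->|_]; last by rewrite subn0 add0r.
  by rewrite [RHS]subnKC // lt0n.
by rewrite e -mon_delta coef_mul_mon /fps_deriv addrC !ffunE eqxx.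
Qed.

Lemma deriv_mul j f g :
  fps_deriv j (f * g) = fps_deriv j f * g + f * fps_deriv j g.
Proof.
apply: (@var_mulI j); rewrite mulrDr mulrA [in X in _ = _ + X]mulrCA; apply/funext => a.
rewrite coef_var_deriv coefD !(fps_coefM _ _ (leqnn _)) -big_split mulr_sumr /=.
apply: eq_bigr => b _; rewrite -big_split mulr_sumr /=; apply: eq_bigr => c /eqP e.
have -> : a j = (mval b j + mval c j)%N by have /ffunP/(_ j) := e; rewrite ffunE.
by rewrite !coef_var_deriv -!mulrA [f _ * (_ * _)]mulrCA -mulrDl natrD.
Qed.

Lemma deriv_lin j x f g :
  fps_deriv j (x *: f + g) = x *: fps_deriv j f + fps_deriv j g.
Proof.
apply/funext => a; rewrite /fps_deriv !coefD !coefZ mulrDr.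
by rewrite [X in X + _]mulrCA.
Qed.

Lemma ord_deriv k j f : ord k.+1 f -> ord k (fps_deriv j f).
Proof.
by move=> hf a ak; rewrite /fps_deriv hf ?mulr0 // mdegD mdeg_delta addn1.
Qed.

Lemma deriv_var i j : fps_deriv i (fps_var j) = (i == j)%:R :> fps K n.
Proof.
apply: (@var_mulI i); apply/funext => a; rewrite coef_var_deriv /fps_var.
have [<-|ij] := eqVneq i j.
  rewrite mulr1; case: eqP => [->|_]; last by rewrite mulr0.
  by rewrite ffunE eqxx mulr1.
rewrite mulr0; case: eqP => [->|_]; last by rewrite mulr0.
by rewrite ffunE (negbTE ij) mul0r.
Qed.

Lemma vfield_actE (X : formal_map K n) f :
  vfield_act X f = \sum_(j < n) X j * fps_deriv j f.
Proof. by apply/funext => a; rewrite coef_sum. Qed.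

Lemma vfield_act_der (X : formal_map K n) : formal_vfield X -> fder id (vfield_act X).
Proof.
move=> hX; split; first split=> [x f g|k f hf].
- rewrite !vfield_actE scaler_sumr -big_split; apply: eq_bigr => j _.
  by rewrite deriv_lin mulrDr scalerAr.
- rewrite vfield_actE; apply: ord_sum => j _; case: k hf => // k hf.
  by rewrite -add1n; apply: ordM; [apply/ord1P/hX | apply: ord_deriv].
move=> f g; rewrite !vfield_actE mulr_suml mulr_sumr -big_split; apply: eq_bigr => j _.
by rewrite deriv_mul mulrDr mulrA [f * (_ * _)]mulrCA.
Qed.

Lemma vfield_act_var (X : formal_map K n) j : vfield_act X (fps_var j) = X j.
Proof.
rewrite vfield_actE (bigD1 j) //= big1 => [|i ij]; rewrite deriv_var.
  by rewrite eqxx mulr1 addr0.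
by rewrite (negbTE ij) mulr0.
Qed.

(** Derivations are vector fields: logarithm and conjugation produce derivations, and this turns
    them back into a tuple of series. *)
Lemma fder_vfield_act L : fder id L -> L =1 vfield_act (fun j => L (fps_var j)).
Proof.
move=> hL; apply: (fder_ext fhom_id hL); last by move=> j; rewrite vfield_act_var.
apply: vfield_act_der => j; apply/ord1P; apply: flin_ord; [exact: hL.1 | exact: ord_var].
Qed.

Section Composition.
Variables (eta : formal_map K n) (h_eta : formal_vfield eta).

Lemma ord_pow b : ord (mdeg b) (formal_map_pow eta b).
Proof. by rewrite formal_map_powE; apply: ord_prod => i; apply/ordX/ord1P/h_eta. Qed.

Lemma fps_comp_flin : flin (fun f => fps_comp f eta).
Proof.
split=> [x f g|k f hf a ak].
  apply/funext => a; rewrite coefD coefZ /fps_comp mulr_sumr -big_split /=.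
  by apply: eq_bigr => b _; rewrite coefD coefZ mulrDl mulrA.
rewrite /fps_comp big1 // => b _; have [bk|kb] := ltnP (mdeg (mval b)) k.
  by rewrite hf // mul0r.
by rewrite ord_pow ?mulr0 // (leq_trans ak).
Qed.

Lemma fps_comp_mon b : fps_comp (mon b) eta = formal_map_pow eta b.
Proof.
apply/funext => a; rewrite /fps_comp.
have [ba|ab] := leqP (mdeg b) (mdeg a).
  rewrite (bigD1 (mbox _ b)) //= mboxK_deg // big1 ?addr0 /mon ?eqxx ?mul1r // => c cb.
  case: eqP => [e|]; last by rewrite mul0r.
  by case/eqP: cb; rewrite -(mvalK c) e.
rewrite [RHS]ord_pow // big1 // => c _; rewrite /mon; case: eqP => [->|].
  by rewrite ord_pow ?mulr0.
by rewrite mul0r.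
Qed.

Lemma fps_comp_var j : fps_comp (fps_var j) eta = eta j.
Proof.
rewrite -mon_delta fps_comp_mon formal_map_powE (bigD1 j) //= big1 => [|i ij].
  by rewrite ffunE eqxx expr1 mulr1.
by rewrite ffunE (negbTE ij).
Qed.

Lemma formal_map_powD b c :
  formal_map_pow eta (b + c) = formal_map_pow eta b * formal_map_pow eta c.
Proof.
rewrite !formal_map_powE -big_split; apply: eq_bigr => j _.
by rewrite ffunE exprD.
Qed.

Lemma fps_comp_hom : fhom (fun f => fps_comp f eta).
Proof.
have hl := fps_comp_flin; split=> // [|f g].
  by rewrite -mon0 fps_comp_mon formal_map_powE big1 // => j _; rewrite ffunE.
(* Multiplicativity is reduced to monomials by continuity, in one factor and then in the other. *)
suff e b : fps_comp (mon b * g) eta = fps_comp (mon b) eta * fps_comp g eta.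
  apply: (flin_ext (L1 := fun f => fps_comp (f * g) eta)
    (L2 := fun f => fps_comp f eta * fps_comp g eta)) e f.
    apply: (flin_comp hl); exact: flin_mulr flin_id.
  exact: flin_mulr.
apply: (flin_ext (L1 := fun g => fps_comp (mon b * g) eta)
    (L2 := fun g => fps_comp (mon b) eta * fps_comp g eta)) g.
- exact: (flin_comp hl (flin_mul _)).
- exact: (flin_comp (flin_mul _) hl).
by move=> c; rewrite -monM !fps_comp_mon formal_map_powD.
Qed.

(** Continuous algebra endomorphisms are substitutions, so that associativity of composition is
    inherited from that of operators. *)
Lemma fhom_fps_comp L : fhom L -> (forall j, L (fps_var j) = eta j) ->
  L =1 fun f => fps_comp f eta.
Proof. by move=> hL e; apply: fhom_ext => // [|j]; [apply: fps_comp_hom | rewrite e fps_comp_var]. Qed.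

Lemma fps_comp_vfield psi : formal_vfield psi -> formal_vfield (formal_map_comp psi eta).
Proof. by move=> h j; apply/ord1P/(flin_ord fps_comp_flin)/ord1P/h. Qed.


End Composition.

Lemma fps_compA f (psi eta : formal_map K n) : formal_vfield psi -> formal_vfield eta ->
  fps_comp (fps_comp f psi) eta = fps_comp f (formal_map_comp psi eta).
Proof.
move=> h h'; have hc := fps_comp_vfield h' h.
apply: (fhom_fps_comp hc (L := fun f => fps_comp (fps_comp f psi) eta)).
  exact: (fhom_comp (fps_comp_hom h') (fps_comp_hom h)).
by move=> j; rewrite (fps_comp_var h).
Qed.

Lemma formal_map_compA (chi psi eta : formal_map K n) : formal_vfield psi -> formal_vfield eta ->
  formal_map_comp (formal_map_comp chi psi) eta = formal_map_comp chi (formal_map_comp psi eta).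
Proof. by move=> h h'; apply/funext => j; apply: fps_compA. Qed.

Lemma formal_vfield_id : formal_vfield (@formal_map_id K n).
Proof. by move=> j; apply/ord1P; apply: ord_var. Qed.

Lemma fps_comp_id f : fps_comp f formal_map_id = f.
Proof. by rewrite -(fhom_fps_comp formal_vfield_id fhom_id). Qed.

Lemma formal_map_comp_id (eta : formal_map K n) : formal_map_comp eta formal_map_id = eta.
Proof. by apply/funext => j; apply: fps_comp_id. Qed.

Lemma formal_map_id_comp (eta : formal_map K n) : formal_vfield eta ->
  formal_map_comp formal_map_id eta = eta.
Proof. by move=> h; apply/funext => j; apply: fps_comp_var. Qed.


Lemma fder_comp_hom H L : fhom H -> fder id L -> fder H (fun f => L (H f)).
Proof.
move=> [hH H1 HM] [hL lM]; split=> [|f g]; first exact: flin_comp.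
by rewrite HM lM.
Qed.

Lemma fder_hom_comp H L : fhom H -> fder id L -> fder H (fun f => H (L f)).
Proof.
move=> [hH H1 HM] [hL lM]; split=> [|f g]; first exact: flin_comp.
by rewrite lM (flinD hH) !HM.
Qed.

Lemma fder_conj H H' L : fhom H -> fhom H' -> cancel H' H -> fder id L ->
  fder id (fun f => H (L (H' f))).
Proof.
move=> [hH H1 HM] [hH' H1' HM'] HK [hL lM]; split=> [|f g].
  exact: flin_comp hH (flin_comp hL hH').
by rewrite HM' lM (flinD hH) !HM !HK.
Qed.

End Operators.

(** * Series with coefficients in a subring, for the real case *)

Section Over.
Variables (K : fieldType) (n : nat) (S : subringClosed K).
Implicit Types (f g : fps K n).

Definition fps_over f := forall a, f a \in S.

Lemma over_var j : fps_over (fps_var j).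
Proof. by move=> a; rewrite /fps_var; case: (a == _); rewrite ?rpred1 ?rpred0. Qed.

Lemma overD f g : fps_over f -> fps_over g -> fps_over (f + g).
Proof. by move=> hf hg a; rewrite rpredD. Qed.

Lemma overB f g : fps_over f -> fps_over g -> fps_over (f - g).
Proof. by move=> hf hg a; rewrite rpredB. Qed.

Lemma overZ x f : x \in S -> fps_over f -> fps_over (x *: f).
Proof. by move=> hx hf a; rewrite rpredM. Qed.

Lemma over_sum I (r : seq I) (F : I -> fps K n) :
  (forall i, fps_over (F i)) -> fps_over (\sum_(i <- r) F i).
Proof. by move=> h a; rewrite coef_sum; apply: rpred_sum => i _; apply: h. Qed.

Lemma overM f g : fps_over f -> fps_over g -> fps_over (f * g).
Proof.
move=> hf hg a; rewrite (fps_coefM _ _ (leqnn _)); apply: rpred_sum => b _.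
by apply: rpred_sum => c _; rewrite rpredM.
Qed.

Lemma over1 : fps_over 1.
Proof. by move=> a; rewrite coef1; case: (a == _); rewrite ?rpred1 ?rpred0. Qed.

Lemma over_pow (eta : formal_map K n) b : (forall j, fps_over (eta j)) ->
  fps_over (formal_map_pow eta b).
Proof.
move=> h; rewrite formal_map_powE; elim/big_rec: _ => [|j f _ hf]; first exact: over1.
apply: overM => //; elim: (b j) => [|k IH]; first exact: over1.
by rewrite exprS; apply: overM.
Qed.

Lemma over_comp f (eta : formal_map K n) : fps_over f -> (forall j, fps_over (eta j)) ->
  fps_over (fps_comp f eta).
Proof. by move=> hf h a; apply: rpred_sum => b _; rewrite rpredM // over_pow. Qed.

Lemma over_deriv j f : fps_over f -> fps_over (fps_deriv j f).
Proof. by move=> hf a; rewrite rpredM // rpred_nat. Qed.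

Lemma over_vfield_act (X : formal_map K n) f : (forall j, fps_over (X j)) -> fps_over f ->
  fps_over (vfield_act X f).
Proof.
by move=> hX hf; rewrite vfield_actE; apply: over_sum => j; apply/overM/over_deriv.
Qed.

End Over.

(** * Linear parts and inverses *)

Section Jets.
Variables (K : fieldType) (n : nat).
Implicit Types (f g h : fps K n) (L : fps K n -> fps K n).
Implicit Types (v : 'rV[K]_n) (A B : 'M[K]_n) (eta psi : formal_map K n).

Lemma flin_ord_mon L e : flin L -> (forall b, ord (mdeg b + e) (L (mon K b))) ->
  forall k f, ord k f -> ord (k + e) (L f).
Proof.
move=> hL h k f hf a ak; rewrite (flin_coef hL _ (leqnn _)) big1 // => b _.
have [bk|kb] := ltnP (mdeg (mval b)) k; first by rewrite hf // mul0r.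
by rewrite h ?mulr0 // (leq_trans ak) // leq_add2r.
Qed.

Definition linform v : fps K n := \sum_(k < n) v 0 k *: fps_var k.

Definition jetr f : 'rV[K]_n := \row_k f (mdelta k).

(** The composite A o eta of [linear_comp], in a form on which operators acting on each component
    visibly commute with A ([flin_mxact]). *)
Definition mxact A eta : formal_map K n := fun j => \sum_(k < n) A j k *: eta k.

Lemma mdelta_inj (i j : 'I_n) : (mdelta i == mdelta j) = (i == j).
Proof.
apply/eqP/eqP => [/ffunP/(_ i)|-> //]; rewrite !ffunE eqxx.
by case: (i =P j).
Qed.

Lemma linform_delta v k : linform v (mdelta k) = v 0 k.
Proof.
rewrite /linform coef_sum (bigD1 k) //= big1 => [|i ik]; rewrite coefZ /fps_var mdelta_inj.
  by rewrite eqxx mulr1 addr0.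
by rewrite eq_sym (negbTE ik) mulr0.
Qed.

Lemma ord_linform v : ord 1 (linform v).
Proof. by apply: ord_sum => k _; apply/ordZ/ord_var. Qed.

Lemma jetr_linform v : jetr (linform v) = v.
Proof. by apply/rowP => k; rewrite mxE linform_delta. Qed.

Lemma ord2_jetr f : ord 1 f -> ord 2 (f - linform (jetr f)).
Proof.
move=> f1; apply: ord_mdelta => [|k]; first exact/ordB/ord_linform.
by rewrite coefB linform_delta mxE subrr.
Qed.

Lemma linear_formal_mapE A j : linear_formal_map A j = linform (row j A).
Proof.
apply/funext => a; rewrite /linform coef_sum; apply: eq_bigr => k _.
by rewrite coefZ mxE.
Qed.

Lemma linear_formal_mxact A : linear_formal_map A = mxact A formal_map_id.
Proof.
apply/funext => j; rewrite linear_formal_mapE; apply: eq_bigr => k _.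
by rewrite mxE.
Qed.

Lemma linear_formal_vfield A : formal_vfield (linear_formal_map A).
Proof. by move=> j; rewrite linear_formal_mapE; apply/ord1P/ord_linform. Qed.

Lemma jet1_linear A : jet1 (linear_formal_map A) = A.
Proof. by apply/matrixP => i j; rewrite mxE linear_formal_mapE linform_delta mxE. Qed.

Lemma row_jet1 eta j : row j (jet1 eta) = jetr (eta j).
Proof. by apply/rowP => k; rewrite !mxE. Qed.

Lemma jet1_id : jet1 (@formal_map_id K n) = 1%:M.
Proof. by apply/matrixP => i j; rewrite !mxE /formal_map_id /fps_var mdelta_inj eq_sym. Qed.

Lemma flin_mxact L A eta j : flin L -> L (mxact A eta j) = mxact A (fun k => L (eta k)) j.
Proof. by move=> hL; rewrite (flin_sum hL); apply: eq_bigr => k _; rewrite (flinZ hL). Qed.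

Lemma flin_linform L v : flin L -> L (linform v) = \sum_(k < n) v 0 k *: L (fps_var k).
Proof. by move=> hL; rewrite (flin_sum hL); apply: eq_bigr => k _; rewrite (flinZ hL). Qed.

Lemma mxactM A B eta : mxact (A *m B) eta = mxact A (mxact B eta).
Proof.
apply/funext => j; rewrite /mxact.
under [RHS]eq_bigr do rewrite scaler_sumr.
rewrite exchange_big /=; apply: eq_bigr => k _; rewrite mxE scaler_suml.
by apply: eq_bigr => i _; rewrite scalerA.
Qed.

Lemma mxact1 eta : mxact 1%:M eta = eta.
Proof.
apply/funext => j; rewrite /mxact (bigD1 j) //= big1 => [|k kj]; rewrite mxE.
  by rewrite eqxx scale1r addr0.
by rewrite eq_sym (negbTE kj) scale0r.
Qed.

Lemma mxact_diag (d : 'rV[K]_n) eta j : mxact (diag_mx d) eta j = d 0 j *: eta j.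
Proof.
rewrite /mxact (bigD1 j) //= big1 => [|k kj]; rewrite mxE.
  by rewrite eqxx mulr1n addr0.
by rewrite eq_sym (negbTE kj) mulr0n scale0r.
Qed.

Lemma mxact_vfield A eta : formal_vfield eta -> formal_vfield (mxact A eta).
Proof. by move=> h j; apply/ord1P/ord_sum => k _; apply/ordZ/ord1P/h. Qed.

Lemma linear_comp A eta : formal_vfield eta ->
  formal_map_comp (linear_formal_map A) eta = mxact A eta.
Proof.
move=> h; apply/funext => j; rewrite /formal_map_comp linear_formal_mxact.
apply: (etrans (flin_mxact A formal_map_id j (fps_comp_flin h))).
by apply: eq_bigr => k _; rewrite fps_comp_var.
Qed.

Lemma linear_compM A B : formal_map_comp (linear_formal_map A) (linear_formal_map B)
  = linear_formal_map (A *m B).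
Proof.
rewrite linear_comp; last exact: linear_formal_vfield.
by rewrite !linear_formal_mxact mxactM.
Qed.

Lemma linear1 : linear_formal_map 1%:M = @formal_map_id K n.
Proof. by rewrite linear_formal_mxact mxact1. Qed.

Lemma fps_comp_linK A B : A *m B = 1%:M ->
  cancel (fun f => fps_comp f (linear_formal_map A)) (fun f => fps_comp f (linear_formal_map B)).
Proof.
move=> AB f; rewrite fps_compA; try exact: linear_formal_vfield.
by rewrite linear_compM AB linear1 fps_comp_id.
Qed.

(** An operator acts on functions, hence on the right on the row of a linear form; its iterates then
    give powers of one matrix. *)
Lemma jetr_flin L f : flin L -> ord 1 f ->
  jetr (L f) = jetr f *m jet1 (fun j => L (fps_var j)).
Proof.
move=> hL f1; apply/rowP => k; have h := flin_ord hL (ord2_jetr f1).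
rewrite !mxE (flinB hL) in h *.
rewrite (ord_eq h) ?mdeg_delta // flin_linform // coef_sum.
by apply: eq_bigr => i _; rewrite coefZ !mxE.
Qed.

Lemma jet1_flin L eta : flin L -> formal_vfield eta ->
  jet1 (fun j => L (eta j)) = jet1 eta *m jet1 (fun j => L (fps_var j)).
Proof.
move=> hL h; apply/row_matrixP => j; rewrite row_mul !row_jet1.
by apply: jetr_flin => //; apply/ord1P/h.
Qed.

Lemma jet1_comp psi eta : formal_vfield psi -> formal_vfield eta ->
  jet1 (formal_map_comp psi eta) = jet1 psi *m jet1 eta.
Proof.
move=> hp he; rewrite /formal_map_comp (jet1_flin (fps_comp_flin he)) //.
by congr (_ *m jet1 _); apply/funext => j; rewrite fps_comp_var.
Qed.

Lemma jet1_mxact A eta : jet1 (mxact A eta) = A *m jet1 eta.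
Proof.
apply/matrixP => i j; rewrite !mxE /mxact coef_sum; apply: eq_bigr => k _.
by rewrite coefZ mxE.
Qed.

Definition tangent_id eta := forall j, ord 2 (eta j - fps_var j).

Lemma tangent_id_vfield eta : tangent_id eta -> formal_vfield eta.
Proof.
move=> h j; rewrite -[eta j](subrK (fps_var j)); apply/ord1P/ordD/ord_var.
exact: ord_le (h j).
Qed.

Lemma tangent_id_jet1 eta : tangent_id eta -> jet1 eta = 1%:M.
Proof.
move=> h; rewrite -jet1_id; apply/matrixP => i j; rewrite !mxE.
by apply: (ord_eq (h i)); rewrite mdeg_delta.
Qed.

Section Inverse.
Variables (eta : formal_map K n) (h_eta : tangent_id eta).

Definition comp_defect f := f - fps_comp f eta.

Let hv := tangent_id_vfield h_eta.

Lemma flin_comp_defect : flin comp_defect.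
Proof.
split=> [x f g|k f hf].
  by rewrite /comp_defect (flinP (fps_comp_flin hv)) opprD addrACA scalerBr.
by apply: ordB => //; exact: (flin_ord (fps_comp_flin hv) hf).
Qed.

(** Induction on monomials m, with T the substitution of eta: z_j m - eta_j T m = z_j (m - T m) -
    (eta_j - z_j) T m, where eta_j - z_j has order 2. *)
Lemma ord_comp_defect k f : ord k f -> ord k.+1 (comp_defect f).
Proof.
have [hT T1 TM] := fps_comp_hom hv.
rewrite -addn1; apply: flin_ord_mon k f; first exact: flin_comp_defect.
apply: mindex_ind => [|j b IH]; first by rewrite /comp_defect mon0 T1 subrr.
rewrite monM mon_delta.
have -> : comp_defect (fps_var j * mon K b) =
  fps_var j * comp_defect (mon K b) - (eta j - fps_var j) * fps_comp (mon K b) eta.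
  by rewrite /comp_defect TM fps_comp_var // mulrBr mulrBl opprB addrA subrK.
rewrite mdegD mdeg_delta; apply: ordB.
  by rewrite -addnA; apply: ordM => //; apply: ord_var.
by rewrite addnAC; apply: ordM => //; apply: (flin_ord hT); apply: ord_mon.
Qed.

Lemma ord_iter_defect i f : ord i (iter i comp_defect f).
Proof. by elim: i => // i IH; apply: ord_comp_defect. Qed.

(* Neumann series of f |-> f o eta = f - comp_defect f. *)
Definition comp_inv f : fps K n := fun a =>
  \sum_(i < (mdeg a).+1) iter i comp_defect f a.

Lemma comp_invE N f : ord N (comp_inv f - \sum_(i < N) iter i comp_defect f).
Proof.
move=> a aN; rewrite coefB coef_sum /comp_inv.
rewrite -(big_mkord xpredT (fun i => iter i comp_defect f a)).
rewrite -(big_mkord xpredT (fun i => iter i comp_defect f a)).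
rewrite (big_cat_nat (leq0n (mdeg a).+1) aN) /= opprD addrA subrr add0r.
rewrite big_nat big1 ?oppr0 // => i /andP [ai _]; exact: ord_iter_defect.
Qed.

Lemma comp_invK f : fps_comp (comp_inv f) eta = f.
Proof.
apply/eqP; rewrite -subr_eq0; apply/eqP/ord_eq0 => N.
have hT := fps_comp_flin hv; have h := flin_ord hT (@comp_invE N f).
rewrite (flinB hT) in h.
have e : fps_comp (\sum_(i < N) iter i comp_defect f) eta = f - iter N comp_defect f.
  elim: N {h} => [|N IH]; first by rewrite big_ord0 (flin0 hT) subrr.
  rewrite big_ord_recr /= (flinD hT) IH -addrA; congr (_ + _).
  by rewrite {2}/comp_defect opprB addrC.
rewrite e opprB addrA addrAC in h.
rewrite -[_ - f](addrK (iter N comp_defect f)); apply: ordB; first exact: h.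
exact: ord_iter_defect.
Qed.

Lemma tangent_id_left_inverse : exists psi, [/\ tangent_id psi,
  formal_map_comp psi eta = formal_map_id &
  forall S : subringClosed K, (forall j a, eta j a \in S) -> forall j a, psi j a \in S].
Proof.
exists (fun j => comp_inv (fps_var j)); split=> [j||S hS j a].
- have := @comp_invE 2 (fps_var j).
  rewrite !big_ord_recr big_ord0 /= add0r => h.
  rewrite -[_ - _](subrK (comp_defect (fps_var j))); apply: ordD.
    by rewrite -addrA -opprD.
  by apply/ord_comp_defect/ord_var.
- by apply/funext => j; apply: comp_invK.
have S_iter k : fps_over S (iter k comp_defect (fps_var j)).
  by elim: k => [|k IH]; [apply: over_var | apply: overB => //; apply: over_comp].
by apply: rpred_sum => i _; apply: S_iter.
Qed.

End Inverse.

(** The left inverse psi is again tangent to the identity, hence has a left inverse chi, and eta =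
    chi o psi o eta = chi. *)
Lemma tangent_id_inverse eta : tangent_id eta -> exists psi, [/\ tangent_id psi,
  formal_map_inverse eta psi &
  forall S : subringClosed K, (forall j a, eta j a \in S) -> forall j a, psi j a \in S].
Proof.
move=> h; have [psi [hpsi psi_eta S_psi]] := tangent_id_left_inverse h.
exists psi; split=> //; split=> //; have [chi [hchi chi_psi _]] := tangent_id_left_inverse hpsi.
have [ve vp vc] : [/\ formal_vfield eta, formal_vfield psi & formal_vfield chi].
  by split; apply: tangent_id_vfield.
suff -> : eta = chi by [].
by rewrite -[eta]formal_map_id_comp // -chi_psi formal_map_compA // psi_eta formal_map_comp_id.
Qed.

End Jets.

(** * Logarithms of unipotent maps *)

(** The reindexing behind truncated Cauchy products. *)
Lemma sum_triangle (V : nmodType) M (F : nat -> nat -> V) :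
  \sum_(m < M) \sum_(i < m.+1) F i (m - i)%N =
  \sum_(i < M) \sum_(j < M | (i + j < M)%N) F i j.
Proof.
transitivity (\sum_(m < M) \sum_(i < M | (i < m.+1)%N) F i (m - i)%N).
  by apply: eq_bigr => m _; rewrite (big_ord_widen _ (fun i => F i (m - i)%N) (ltn_ord m)).
rewrite (exchange_big_dep xpredT) //=; apply: eq_bigr => i _.
transitivity (\sum_(i <= m < M) F i (m - i)%N).
  rewrite big_geq_mkord; apply: eq_bigl => m /=; by rewrite ltnS.
rewrite -{1}[nat_of_ord i]add0n big_addn big_mkord.
rewrite (big_ord_widen_cond _ (fun=> true) (fun j => F i (j + i - i)%N) (leq_subr i M)) /=.
apply: eq_big => [j|j _]; last by rewrite addnK.
by rewrite ltn_subRL.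
Qed.

(** The induction step shared by Newton's formula for U^t, the Leibniz formula for D^m and the
    binomial formula for commuting operators. *)
Lemma sum_pascal (V : nmodType) t (G : nat -> V) :
  \sum_(m < t.+2) G m *+ 'C(t.+1, m) =
  \sum_(m < t.+1) G m *+ 'C(t, m) + \sum_(m < t.+1) G m.+1 *+ 'C(t, m).
Proof.
rewrite big_ord_recl bin0.
under eq_bigr => m _ do rewrite lift0 binS mulrnDr.
rewrite big_split addrA; congr (_ + _).
rewrite [in RHS]big_ord_recl bin0; congr (_ + _).
by rewrite big_ord_recr /= bin_small // mulr0n addr0.
Qed.

(** * Operators nilpotent modulo each degree *)

Section Nilpotency.
Variables (K : fieldType) (n : nat).
Implicit Types (f g h : fps K n) (L : fps K n -> fps K n).

Lemma ord_iter L k m f : flin L -> ord k f -> ord k (iter m L f).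
Proof. by move=> hL; apply: flin_ord (flin_iter m hL) _ _. Qed.

Lemma ord_iter_ge L k p m f : flin L -> ord k (iter p L f) -> (p <= m)%N -> ord k (iter m L f).
Proof. by move=> hL h pm; rewrite -(subnK pm) iterD; apply: ord_iter. Qed.

(** The product rule covers two cases: x = 1 for U - 1 with U an algebra morphism, x = 0 for D - c
    with D a derivation. Expanding C^(p + q) (f g) gives terms A^i f B^j g with i + j >= p + q, so
    that i >= p or j >= q. *)
Lemma nilpotent_mul (A B C : fps K n -> fps K n) (x : K) : flin A -> flin B -> flin C ->
  (forall f g, C (f * g) = A f * g + f * B g + x *: (A f * B g)) ->
  forall p q f g d e d' e' k, ord d f -> ord e g -> ord d' (iter p A f) ->
  ord e' (iter q B g) -> (k <= d' + e)%N -> (k <= d + e')%N ->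
  ord k (iter (p + q) C (f * g)).
Proof.
move=> hA hB hC CM p q.
have [s] := ubnP (p + q)%N; elim: s p q => // s IH [|p] [|q] sp f g d e d' e' k hf hg hfp hgq k1 k2.
- by apply: ord_le k1 _; apply: ordM.
- by apply: ord_iter => //; apply: ord_le k1 _; apply: ordM.
- by apply: ord_iter => //; apply: ord_le k2 _; apply: ordM.
have hiter := flin_iter (p + q.+1) hC.
rewrite addSn iterSr CM !(flinD hiter) (flinZ hiter).
have hAf : ord d (A f) by apply: flin_ord hf.
have hBg : ord e (B g) by apply: flin_ord hg.
rewrite iterSr in hfp; rewrite iterSr in hgq.
apply: ordD; first apply: ordD.
- apply: (IH p q.+1 _ _ _ d e d' e') => //; last by rewrite iterSr.
- rewrite addnS -addSn; apply: (IH p.+1 q _ _ _ d e d' e') => //; last by rewrite iterSr.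
  by rewrite addSn -addnS.
(* The mixed term has advanced both factors: p + q iterations suffice, and the one left over keeps
   the order. *)
apply: ordZ; rewrite addnS /=; apply: flin_ord => //; apply: (IH p q _ _ _ d e d' e') => //.
by rewrite -ltnS (leq_trans _ sp) // !addSn addnS !ltnS leqnSn.
Qed.

(** V depends on the monomial so as to include D - weight b besides a fixed U - 1. The hypothesis on
    the variables is modulo order 2 and only concerns linear parts. *)
Lemma nilpotent_mon (V : mindex n -> fps K n -> fps K n) (x : K) : (forall b, flin (V b)) ->
  (forall j b f g, V (mdelta j + b) (f * g) =
     V (mdelta j) f * g + f * V b g + x *: (V (mdelta j) f * V b g)) ->
  V 0 1 = 0 -> (forall j, exists p, ord 2 (iter p (V (mdelta j)) (fps_var j))) ->
  forall b, exists p, ord (mdeg b).+1 (iter p (V b) (mon K b)).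
Proof.
move=> hV VM V1 Vz; apply: mindex_ind => [|j b [q hq]].
  by exists 1%N; rewrite /= mon0 V1.
have [p hp] := Vz j; exists (p + q)%N; rewrite monM mon_delta.
apply: (nilpotent_mul (hV _) (hV _) (hV _) (VM j b) (@ord_var _ _ j) (@ord_mon _ _ b) hp hq).
  by rewrite mdegD mdeg_delta.
by rewrite mdegD mdeg_delta addnS.
Qed.

Lemma exists_bound (I : finType) (P : I -> nat -> Prop) :
  (forall i p q, P i p -> (p <= q)%N -> P i q) ->
  (forall i, exists p, P i p) -> exists p, forall i, P i p.
Proof.
move=> Pmono /choice [p hp]; exists (\sum_i p i)%N => i.
by apply: Pmono (hp i) _; rewrite (bigD1 i) //= leq_addr.
Qed.

(** Modulo order k + 1, a series of order k is a finite combination of monomials of degree at least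
    k, and a common exponent raises the order of all of them beyond k. *)
Lemma locally_nilpotent L : flin L ->
  (forall b, exists p, ord (mdeg b).+1 (iter p L (mon K b))) ->
  forall k f, exists p, ord k (iter p L f).
Proof.
move=> hL h k f; elim: k => [|k [p hp]]; first by exists 0%N.
have [q hq] : exists q, forall b : box n k, ord (mdeg (mval b)).+1 (iter q L (mon K (mval b))).
  by apply: exists_bound => [b q r|b]; [apply: ord_iter_ge | apply: h].
exists (q + p)%N; rewrite iterD; set g := iter p L f in hp *.
have hq' := flin_iter q hL.
rewrite -[g](subrK (\sum_(b : box n k) g (mval b) *: mon K (mval b))) (flinD hq').
apply: ordD; first by apply: ord_iter => //; apply: ord_trunc.
rewrite (flin_sum hq'); apply: ord_sum => b _; rewrite (flinZ hq').
have [bk|kb] := ltnP (mdeg (mval b)) k; first by rewrite hp // scale0r.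
by apply: ordZ; apply: ord_le (hq b).
Qed.

End Nilpotency.

Section PolyAux.
Variable K : numFieldType.
Implicit Types p q : {poly K}.

Lemma poly_nat_inj p q : (forall t : nat, p.[t%:R] = q.[t%:R]) -> p = q.
Proof.
move=> h; apply/eqP; rewrite -subr_eq0; apply/eqP.
apply: (@roots_geq_poly_eq0 _ _ [seq t%:R | t <- iota 0 (size (p - q))]).
- by apply/allP => _ /mapP [t _ ->]; rewrite /root hornerD hornerN h subrr.
- by rewrite map_inj_uniq ?iota_uniq // => s t /eqP; rewrite eqr_nat => /eqP.
by rewrite size_map size_iota.
Qed.

Definition bin_poly m : {poly K} := (m`!%:R)^-1 *: \prod_(i < m) ('X - i%:R%:P).

Lemma bin_polyE m t : (bin_poly m).[t%:R] = 'C(t, m)%:R.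
Proof.
have e : (\prod_(i < m) ('X - i%:R%:P : {poly K})).[t%:R] = (t ^_ m)%:R.
  elim: m => [|m IH]; first by rewrite big_ord0 hornerC.
  rewrite big_ord_recr hornerM IH ffactnSr natrM hornerXsubC.
  have [mt|tm] := leqP m t; first by rewrite natrB.
  by rewrite ffact_small // !mul0r.
rewrite hornerZ e -bin_ffact natrM mulrCA mulVf ?mulr1 // pnatr_eq0 -lt0n fact_gt0.
Qed.

Lemma bin_poly_over (S : divringClosed K) m : bin_poly m \is a polyOver S.
Proof.
apply: polyOverZ; first by rewrite rpredV rpred_nat.
by apply: rpred_prod => i _; rewrite polyOverXsubC rpred_nat.
Qed.

Lemma coef1_comp_poly p (c : K) : (p \Po ('X + c%:P))`_1 = p^`().[c].
Proof.
have -> (q : {poly K}) : q`_1 = q^`().[0] by rewrite horner_coef0 coef_deriv mulr1n.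
by rewrite deriv_comp derivD derivX derivC addr0 mulr1 horner_comp hornerD hornerX hornerC add0r.
Qed.

End PolyAux.

Section Logarithm.
Variables (K : numFieldType) (n : nat) (U : fps K n -> fps K n).
Hypothesis hU : fhom U.
Let V f : fps K n := U f - f.
Hypothesis unip : forall k f, exists p, ord k (iter p V f).
Implicit Types (f g : fps K n) (a : mindex n).

Let hl : flin U. Proof. by case: hU. Qed.

Let hV : flin V.
Proof.
split=> [x f g|k f hf]; first by rewrite /V (flinP hl) opprD addrACA scalerBr.
exact/ordB/hf/(flin_ord hl).
Qed.

Lemma iter_unipotent t f : iter t U f = \sum_(m < t.+1) iter m V f *+ 'C(t, m).
Proof.
elim: t => [|t IH]; first by rewrite big_ord1 bin0.
have -> : iter t.+1 U f = V (iter t U f) + iter t U f by rewrite /V subrK.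
rewrite [in V _]IH (flin_sum hV) IH (sum_pascal t (fun m => iter m V f)) addrC; congr (_ + _).
apply: eq_bigr => m _; rewrite iterS; move: (iter m V f) => g.
by elim: 'C(t, m) => [|k IHk]; rewrite ?(flin0 hV) // !mulrS (flinD hV) IHk.
Qed.

(* (U^t f)_a is a polynomial in t (Newton's forward differences), and log U is
   its derivative at t = 0: identities between the U^t, t a natural number, pass
   to log U because a polynomial is determined by its values on the integers. *)
Lemma iter_poly f a : exists P : {poly K},
  (forall t, P.[t%:R] = iter t U f a) /\
  forall S : divringClosed K, (forall m, fps_over S (iter m V f)) -> P \is a polyOver S.
Proof.
have [p hp] := unip (mdeg a).+1 f.
exists (\sum_(m < p) iter m V f a *: bin_poly K m); split=> [t|S hS]; last first.
  by apply: rpred_sum => m _; apply: polyOverZ; [apply: hS | apply: bin_poly_over].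
rewrite iter_unipotent horner_sum coef_sum.
under eq_bigr do rewrite hornerZ bin_polyE.
pose F m := iter m V f a * 'C(t, m)%:R.
transitivity (\sum_(m < p + t.+1) F m).
  rewrite big_split_ord /= [X in _ + X]big1 ?addr0 // => m _.
  by rewrite /F (ord_iter_ge hV hp (leq_addr _ _)) ?mul0r.
rewrite addnC big_split_ord /= [X in _ + X]big1 ?addr0 => [|m _].
  apply: eq_bigr => m _; rewrite /F mulr_natr.
  by elim: 'C(t, m) => [|k IH]; rewrite ?mulr0n // !mulrS coefD IH.
by rewrite /F bin_small ?mulr0 // ltnS leq_addr.
Qed.

Definition iterpoly f a : {poly K} := sval (cid (iter_poly f a)).

Lemma iterpolyE f a t : (iterpoly f a).[t%:R] = iter t U f a.
Proof. by rewrite /iterpoly; case: cid => P []. Qed.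

Lemma iterpoly_uniq f a P : (forall t, P.[t%:R] = iter t U f a) -> iterpoly f a = P.
Proof. by move=> h; apply: poly_nat_inj => t; rewrite iterpolyE. Qed.

Lemma iterpoly0 f a : (iterpoly f a)`_0 = f a.
Proof. by rewrite -horner_coef0 (iterpolyE f a 0). Qed.

Lemma iterpoly_lin x f g a : iterpoly (x *: f + g) a = x *: iterpoly f a + iterpoly g a.
Proof.
apply: iterpoly_uniq => t; rewrite hornerD hornerZ !iterpolyE.
by rewrite (flinP (flin_iter t hl)).
Qed.

Lemma iterpoly_comm L f a : flin L -> (forall g, L (U g) = U (L g)) ->
  iterpoly (L f) a = \sum_(b : box n (mdeg a)) L (mon K (mval b)) a *: iterpoly f (mval b).
Proof.
move=> hL LU; apply: iterpoly_uniq => t; rewrite horner_sum.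
have -> : iter t U (L f) = L (iter t U f) by elim: t => //= t ->.
rewrite (flin_coef hL _ (leqnn _)); apply: eq_bigr => b _.
by rewrite hornerZ iterpolyE mulrC.
Qed.

Definition flog f : fps K n := fun a => (iterpoly f a)`_1.

Lemma flog_flin : flin flog.
Proof.
split=> [x f g|k f hf a ak].
  by apply/funext => a; rewrite /flog iterpoly_lin coefD coefZ poly.coefD poly.coefZ.
rewrite /flog (_ : iterpoly f a = 0) ?poly.coef0 //; apply: iterpoly_uniq => t.
by rewrite horner0 (flin_ord (flin_iter t hl) hf).
Qed.

(** The coefficient of t in U^t (f g) = (U^t f) (U^t g) is the Leibniz rule. *)
Lemma flog_der : fder id flog.
Proof.
split=> [|f g]; first exact: flog_flin.
apply/funext => a; rewrite /flog.
have -> : iterpoly (f * g) a = \sum_(b : box n (mdeg a))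
    \sum_(c : box n (mdeg a) | mval b + mval c == a) iterpoly f (mval b) * iterpoly g (mval c).
  apply: iterpoly_uniq => t.
  have -> : iter t U (f * g) = iter t U f * iter t U g.
    by case: hU => _ _ UM; elim: t => //= t ->; rewrite UM.
  rewrite (fps_coefM _ _ (leqnn _)) horner_sum; apply: eq_bigr => b _.
  by rewrite horner_sum; apply: eq_bigr => c _; rewrite hornerM !iterpolyE.
rewrite coefD !(fps_coefM _ _ (leqnn _)) poly.coef_sum -big_split; apply: eq_bigr => b _ /=.
rewrite poly.coef_sum -big_split; apply: eq_bigr => c _ /=.
by rewrite poly.coefM big_ord_recr big_ord_recr big_ord0 /= add0r !iterpoly0 addrC.
Qed.

Lemma flog_comm L f : flin L -> (forall g, L (U g) = U (L g)) -> flog (L f) = L (flog f).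
Proof.
move=> hL LU; apply/funext => a; rewrite /flog iterpoly_comm // poly.coef_sum.
rewrite (flin_coef hL _ (leqnn _)); apply: eq_bigr => b _.
by rewrite poly.coefZ mulrC.
Qed.

(** This is d/dt U^t = U^t log U: the derivative at an integer t is the derivative at 0 of the
    translated polynomial, which belongs to U^t f. *)
Lemma iterpoly_flog f a : iterpoly (flog f) a = (iterpoly f a)^`().
Proof.
apply: iterpoly_uniq => t; rewrite -coef1_comp_poly.
have <- : flog (iter t U f) = iter t U (flog f).
  by elim: t => //= t <-; apply: flog_comm.
rewrite /flog; suff -> : iterpoly (iter t U f) a = iterpoly f a \Po ('X + t%:R%:P) by [].
apply: iterpoly_uniq => s; by rewrite horner_comp hornerD hornerX hornerC -natrD iterpolyE iterD.
Qed.

Lemma iter_flogE i f a : iter i flog f a = (iterpoly f a)`_i *+ i`!.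
Proof.
have -> : iter i flog f a = ((iterpoly f a)^`(i))`_0.
  rewrite -iterpoly0; suff -> : iterpoly (iter i flog f) a = (iterpoly f a)^`(i) by [].
  elim: i => // i IH; by rewrite derivnS -IH -iterpoly_flog.
by rewrite coef_derivn addn0 ffactnn.
Qed.

Lemma flog_nilpotent f a : exists p, forall i, (p <= i)%N -> iter i flog f a = 0.
Proof.
exists (size (iterpoly f a)) => i hi.
by rewrite iter_flogE nth_default // mul0rn.
Qed.

(** By [iter_flogE] the terms are the coefficients of the polynomial t |-> (U^t f)_a, whose value at
    t = 1 is (U f)_a. *)
Lemma exp_flog p f a : (forall i, (p <= i)%N -> iter i flog f a = 0) ->
  \sum_(i < p) iter i flog f a / i`!%:R = U f a.
Proof.
move=> h; have fact_neq0 i : i`!%:R != 0 :> K by rewrite pnatr_eq0 -lt0n fact_gt0.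
transitivity (iterpoly f a).[1%:R]; last exact: (iterpolyE f a 1).
have e i : iter i flog f a / i`!%:R = (iterpoly f a)`_i.
  by rewrite iter_flogE -[X in X / _]mulr_natr mulfK.
rewrite (@horner_coef_wide _ p); last first.
  by apply/leq_sizeP => i pi; rewrite -e h // mul0r.
by apply: eq_bigr => i _; rewrite e expr1n mulr1.
Qed.

(** Newton's interpolation only brings in rational coefficients, whence the closure of S under
    division. *)
Lemma flog_over (S : divringClosed K) f : (forall g, fps_over S g -> fps_over S (U g)) ->
  fps_over S f -> fps_over S (flog f).
Proof.
move=> US hf a; rewrite /flog /iterpoly; case: cid => P [_ /(_ S) PS] /=.
apply: polyOverP 1%N; apply: PS => m; elim: m => // m IH.
by apply: overB => //; apply: US.
Qed.

End Logarithm.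

Section NilpotentExp.
Variables (K : numFieldType) (n : nat) (N : 'M[K]_n) (p : nat).
Hypothesis Np : N ^+ p = 0.

Definition nilp_exp (t : K) : 'M[K]_n := \sum_(i < p) (t ^+ i / i`!%:R) *: N ^+ i.

(** The truncated Cauchy product is exact, since N^(i + j) = 0 as soon as i + j >= p. *)
Lemma nilp_expD s t : nilp_exp s *m nilp_exp t = nilp_exp (s + t).
Proof.
have fact_neq0 i : i`!%:R != 0 :> K by rewrite pnatr_eq0 -lt0n fact_gt0.
pose F i j := (s ^+ i / i`!%:R * (t ^+ j / j`!%:R)) *: N ^+ (i + j).
transitivity (\sum_(i < p) \sum_(j < p | (i + j < p)%N) F i j).
  rewrite mulmx_suml; apply: eq_bigr => i _; rewrite mulmx_sumr.
  rewrite [RHS]big_mkcond; apply: eq_bigr => j _.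
  rewrite -scalemxAl -scalemxAr scalerA mulmxE -exprD.
  by case: ltnP => // /subnK <-; rewrite exprD Np mulr0 scaler0.
rewrite -sum_triangle; apply: eq_bigr => m _.
transitivity (\sum_(i < m.+1) (s ^+ i / i`!%:R * (t ^+ (m - i) / (m - i)`!%:R)) *: N ^+ m).
  by apply: eq_bigr => i _; rewrite /F subnKC // -ltnS.
rewrite -scaler_suml; congr (_ *: _).
rewrite addrC exprDn mulr_suml; apply: eq_bigr => i _.
have im : (i <= m)%N by rewrite -ltnS.
rewrite -mulr_natr -(bin_fact im) !natrM.
have c0 : 'C(m, i)%:R != 0 :> K by rewrite pnatr_eq0 -lt0n bin_gt0.
by field; rewrite c0 !fact_neq0.
Qed.

Lemma nilp_exp0 : nilp_exp 0 = 1%:M.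
Proof.
rewrite /nilp_exp; case: p Np => [|q] Nq.
  by rewrite big_ord0 -Nq expr0.
rewrite big_ord_recl /= expr0 fact0 divr1 scale1r big1 ?addr0 // => i _.
by rewrite expr0n /= mul0r scale0r.
Qed.

Lemma nilp_expX t : nilp_exp 1 ^+ t = nilp_exp t%:R.
Proof.
elim: t => [|t IH]; first by rewrite nilp_exp0.
by rewrite exprS IH -mulmxE nilp_expD -mulrS.
Qed.

Lemma nilp_exp_comm (A : 'M[K]_n) t : A *m N = N *m A -> A *m nilp_exp t = nilp_exp t *m A.
Proof.
move=> AN; rewrite mulmx_suml mulmx_sumr; apply: eq_bigr => i _.
rewrite -scalemxAl -scalemxAr; congr (_ *: _).
by rewrite !mulmxE; apply: commrX.
Qed.

Lemma nilp_exp_unipotent : exists q, (nilp_exp 1 - 1%:M) ^+ q = 0.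
Proof.
Abort.

End NilpotentExp.

Section NilpotentExpN.
Variables (K : numFieldType) (n : nat).

Lemma nilp_expN (M : 'M[K]_n) q : nilp_exp (- M) q 1 = nilp_exp M q (- 1).
Proof.
have MN i : (- M) ^+ i = (- 1) ^+ i *: M ^+ i.
  elim: i => [|i IH]; first by rewrite !expr0 scale1r.
  by rewrite !exprS IH -!mulmxE -scalemxAr mulN1r mulNmx scaleNr scalerN.
by apply: eq_bigr => i _; rewrite MN scalerA expr1n mulrAC mul1r.
Qed.

End NilpotentExpN.

Section JetIterates.
Variables (K : numFieldType) (n : nat).
Implicit Types (f : fps K n) (L : fps K n -> fps K n) (u : formal_map K n).

Lemma jetr_iter L f k : flin L -> ord 1 f ->
  jetr (iter k L f) = jetr f *m jet1 (fun j => L (fps_var j)) ^+ k.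
Proof.
move=> hL f1; elim: k => [|k IH]; first by rewrite expr0 mulmx1.
rewrite iterS jetr_flin ?IH; last exact: ord_iter.
  by rewrite exprSr -mulmxE mulmxA.
by [].
Qed.

Lemma ord2_jetr0 f : ord 1 f -> jetr f = 0 -> ord 2 f.
Proof.
move=> f1 /rowP f0; apply: ord_mdelta => // k.
by have := f0 k; rewrite !mxE.
Qed.

(** With V = U - 1, one has V (f g) = V f g + f V g + V f V g: nilpotency passes from the linear
    part to all monomials. *)
Lemma unipotent_comp u q : formal_vfield u -> (jet1 u - 1%:M) ^+ q = 0 ->
  forall k f, exists p, ord k (iter p (fun g => fps_comp g u - g) f).
Proof.
move=> hu uq; have [hl U1 UM] := fps_comp_hom hu.
have hV : flin (fun g => fps_comp g u - g).
  by have := flin_sub 1 hl; under eq_fun do rewrite scale1r.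
apply: (locally_nilpotent hV).
apply: (nilpotent_mon (V := fun=> fun g => fps_comp g u - g) (x := 1)) => // [_ _ f g||j].
- by rewrite UM scale1r; ring.
- by rewrite U1 subrr.
exists q; apply: ord2_jetr0; first by apply: ord_iter => //; apply: ord_var.
rewrite jetr_iter //; last exact: ord_var.
suff -> : jet1 (fun j => fps_comp (fps_var j) u - fps_var j) = jet1 u - 1%:M by rewrite uq mulmx0.
rewrite -jet1_id; apply/matrixP => i k.
by rewrite !mxE fps_comp_var.
Qed.

Lemma nilp_exp_unipotent (N : 'M[K]_n) p : N ^+ p = 0 -> (nilp_exp N p 1 - 1%:M) ^+ p = 0.
Proof.
move=> Np; case: p Np => [|p] Np.
  by rewrite -Np !expr0.
(* [W] is the quotient (e^N - 1) / N, a polynomial in N. *)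
pose W : 'M[K]_n := \sum_(i < p) (i.+1`!%:R)^-1 *: N ^+ i.
have NW : N *m W = W *m N.
  rewrite mulmx_suml mulmx_sumr; apply: eq_bigr => i _.
  by rewrite -scalemxAl -scalemxAr !mulmxE -exprS -exprSr.
have -> : nilp_exp N p.+1 1 - 1%:M = N * W.
  rewrite /nilp_exp big_ord_recl /= expr0 fact0 divr1 scale1r addrC addKr.
  rewrite -mulmxE mulmx_sumr; apply: eq_bigr => i _.
  by rewrite expr1n div1r -scalemxAr mulmxE -exprS.
by rewrite exprMn_comm // Np mul0r.
Qed.

(** On linear parts U^t is e^(t N), a polynomial in t whose coefficient of t is N. *)
Lemma flog_jet1 u N p (hu : formal_vfield u)
  (unip : forall k f, exists p, ord k (iter p (fun g => fps_comp g u - g) f)) :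
  N ^+ p = 0 -> jet1 u = nilp_exp N p 1 ->
  jet1 (fun j => flog (fps_comp_hom hu) unip (fps_var j)) = N.
Proof.
move=> Np ju; apply/matrixP => i k; rewrite mxE /flog.
have -> : iterpoly (fps_comp_hom hu) unip (fps_var i) (mdelta k) =
  \sum_(m < p) ((N ^+ m) i k / m`!%:R) *: 'X^m.
  apply: iterpoly_uniq => t; rewrite horner_sum.
  have -> : iter t (fun f => fps_comp f u) (fps_var i) (mdelta k) = (jet1 u ^+ t) i k.
    have /rowP/(_ k) := jetr_iter t (fps_comp_flin hu) (@ord_var _ _ i).
    rewrite [LHS]mxE => ->; have -> : jetr (fps_var i) = row i 1%:M :> 'rV[K]_n.
      by rewrite -jet1_id row_jet1.
    rewrite -row_mul mul1mx mxE; congr ((jet1 _ ^+ t) i k).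
    by apply/funext => j; rewrite fps_comp_var.
  rewrite ju nilp_expX // /nilp_exp summxE; apply: eq_bigr => m _.
  by rewrite hornerZ hornerXn mxE; ring.
rewrite poly.coef_sum.
have [p1|p1] := leqP p 1.
  (* For p <= 1 the sum has no term of index 1, but then N = 0. *)
  have N0 : N = 0 by rewrite -[N]expr1 -(subnKC p1) exprD Np mul0r.
  rewrite N0 mxE big1 // => m _; rewrite poly.coefZ poly.coefXn.
  by case: p {Np ju} m p1 => [|[|p]] [[|m] hm] //=; rewrite mulr0.
rewrite (bigD1 (Ordinal p1)) //= big1 => [|m m1].
  by rewrite poly.coefZ poly.coefXn eqxx mulr1 expr1 factS fact0 divr1 addr0.
rewrite poly.coefZ poly.coefXn; case: eqP => [e|]; last by rewrite mulr0.
by case/eqP: m1; apply/val_inj.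
Qed.

End JetIterates.

(** * Generalized eigenvectors of a derivation *)

Section GenEigen.
Variables (K : fieldType) (n : nat) (D : fps K n -> fps K n) (hD : fder id D).
Implicit Types (f g h v w : fps K n) (c d : K) (b : mindex n).

Definition shift_op c f : fps K n := D f - c *: f.

(** Generalized eigenvector of D for c on jets of degree below k. The exponent may grow with k, so
    that on series themselves D - c need not be nilpotent. *)
Definition geneig k c f := exists p, ord k (iter p (shift_op c) f).

Lemma flin_shift c : flin (shift_op c).
Proof. exact: flin_sub hD.1. Qed.

Local Notation fl := (flin_shift _).

Lemma shift_opC c d f : shift_op c (shift_op d f) = shift_op d (shift_op c f).
Proof.
rewrite /shift_op !(flinB hD.1) !(flinZ hD.1) !scalerBr !scalerA [d * c]mulrC.
by rewrite !opprB addrACA [RHS]addrACA; congr (_ + _); rewrite addrC.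
Qed.

Lemma geneigD k c f g : geneig k c f -> geneig k c g -> geneig k c (f + g).
Proof.
move=> [p hp] [q hq]; exists (p + q)%N; rewrite (flinD (flin_iter _ fl)).
by apply: ordD; [apply: ord_iter_ge hp _ | apply: ord_iter_ge hq _];
  rewrite ?leq_addr ?leq_addl //; apply: flin_shift.
Qed.

Lemma geneigZ k c x f : geneig k c f -> geneig k c (x *: f).
Proof. by move=> [p hp]; exists p; rewrite (flinZ (flin_iter _ fl)); apply: ordZ. Qed.

Lemma geneig_ord k c f : ord k f -> geneig k c f.
Proof. by exists 0%N. Qed.

Lemma geneigB k c f g : geneig k c f -> geneig k c g -> geneig k c (f - g).
Proof. by move=> hf hg; apply: geneigD => //; rewrite -scaleN1r; apply: geneigZ. Qed.

Lemma geneig_sum k c I (r : seq I) (P : pred I) (F : I -> fps K n) :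
  (forall i, P i -> geneig k c (F i)) -> geneig k c (\sum_(i <- r | P i) F i).
Proof.
move=> h; elim/big_ind: _ => //; last exact: geneigD.
exact: geneig_ord.
Qed.

(** Inversion of D - c = (d - c) + (D - d) where D - d is nilpotent: if h1 solves (D - c) h1 = (D -
    d) v, then (v - h1) / (d - c) solves the equation for v. The last conclusion keeps h in the same
    generalized eigenspace, so that the construction can be iterated. *)
Lemma shift_op_solve k k' c d q v : c != d -> ord k v -> ord k' (iter q (shift_op d) v) ->
  exists h, [/\ ord k h, ord k' (shift_op c h - v) & ord k' (iter q (shift_op d) h)].
Proof.
move=> cd; elim: q v => [|q IH] v hv hq.
  exists 0; split=> //; rewrite (flin0 fl) sub0r; exact: ordN.
rewrite iterSr in hq; have [h1 [h1k h1v h1q]] := IH _ (flin_ord fl hv) hq.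
have dc0 : d - c != 0 by rewrite subr_eq0 eq_sym.
exists ((d - c)^-1 *: (v - h1)); split; first exact/ordZ/ordB.
  rewrite (flinZ fl) (flinB fl) -{2}[v](scalerK dc0) -scalerBr; apply: ordZ.
  have -> : shift_op c v - shift_op c h1 - (d - c) *: v = shift_op d v - shift_op c h1.
    by rewrite addrAC; congr (_ - _); rewrite /shift_op scalerBl opprB addrA subrK.
  by rewrite -opprB; apply: ordN.
rewrite (flinZ (flin_iter _ fl)); apply: ordZ; rewrite (flinB (flin_iter _ fl)); apply: ordB.
  by rewrite iterSr.
by rewrite iterS; apply: flin_ord h1q; apply: flin_shift.
Qed.

Lemma shift_op_solve_iter k k' c d q p v : c != d -> ord k v -> ord k' (iter q (shift_op d) v) ->
  exists h, [/\ ord k h, ord k' (iter p (shift_op c) h - v) & ord k' (iter q (shift_op d) h)].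
Proof.
move=> cd hv hq; elim: p => [|p [h1 [h1k h1v h1q]]].
  by exists v; split=> //; rewrite subrr.
have [h [hk hv' hq']] := shift_op_solve cd h1k h1q; exists h; split=> //.
rewrite iterSr.
have -> : iter p (shift_op c) (shift_op c h) - v =
    iter p (shift_op c) (shift_op c h - h1) + (iter p (shift_op c) h1 - v).
  by rewrite (flinB (flin_iter _ fl)) addrA subrK.
by apply: ordD => //; apply: ord_iter => //; apply: flin_shift.
Qed.

End GenEigen.

Section Intertwining.
Variables (K : fieldType) (n : nat).

Lemma geneig_intertwine (D1 D2 L : fps K n -> fps K n) k c f : flin L ->
  (forall g, D2 (L g) = L (D1 g)) -> geneig D1 k c f -> geneig D2 k c (L f).
Proof.
move=> hL DL [p hp]; exists p.
have -> : iter p (shift_op D2 c) (L f) = L (iter p (shift_op D1 c) f).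
  by elim: p {hp} => //= p ->; rewrite {1}/shift_op DL -(flinZ hL) -(flinB hL).
exact: flin_ord hp.
Qed.

End Intertwining.

Section Weights.
Variables (K : fieldType) (n : nat) (D : fps K n -> fps K n) (hD : fder id D).
Variable gam : 'I_n -> K.
Implicit Types (f g h v w : fps K n) (c d : K) (b : mindex n).

Local Notation sop := (shift_op D).
Local Notation fl := (flin_shift hD _).
Local Notation fli := (flin_iter _ fl).

Definition weight b : K := \sum_(k < n) (b k)%:R * gam k.

Lemma weightD b b' : weight (b + b') = weight b + weight b'.
Proof.
by rewrite /weight -big_split; apply: eq_bigr => k _; rewrite ffunE natrD mulrDl.
Qed.

Lemma weight0 : weight 0 = 0.
Proof. by rewrite /weight big1 // => k _; rewrite ffunE mul0r. Qed.

Lemma weight_delta j : weight (mdelta j) = gam j.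
Proof.
rewrite /weight (bigD1 j) //= big1 => [|k kj]; first by rewrite ffunE eqxx mul1r addr0.
by rewrite ffunE (negbTE kj) mul0r.
Qed.

(** Eigenvalues add under multiplication. The null last term gives the product rule the shape
    required by [nilpotent_mul]. *)
Lemma shift_op_mul c d f g :
  sop (c + d) (f * g) = sop c f * g + f * sop d g + 0 *: (sop c f * sop d g).
Proof.
rewrite /shift_op hD.2 scale0r addr0 scalerDl mulrBl mulrBr scalerAl.
by rewrite [d *: (f * g)]scalerAr opprD addrACA.
Qed.

Section Approximate.
Hypothesis hz : forall j, geneig D 2 (gam j) (fps_var j).

Lemma shift_op_mon b : geneig D (mdeg b).+1 (weight b) (mon K b).
Proof.
apply: (nilpotent_mon (V := fun b => sop (weight b)) (x := 0)) => [b'|j b' f g||j].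
- exact: flin_shift.
- by rewrite weightD shift_op_mul.
- by rewrite /shift_op (fder1 (fhom_id _ _) hD) weight0 scale0r subrr.
by rewrite weight_delta; apply: hz.
Qed.

(* On the span of the z^b with |b| = k and weight b <> c, the operator D - c is
   invertible modulo degree k + 1; on the others it is nilpotent. *)
Lemma shift_op_correct k c p g : ord k g -> exists h q, ord k h /\
  ord k.+1 (iter q (sop c) (g + iter p (sop c) h)).
Proof.
pose G g := exists h q, ord k h /\ ord k.+1 (iter q (sop c) (g + iter p (sop c) h)).
have GD g1 g2 : G g1 -> G g2 -> G (g1 + g2).
  move=> [h1 [q1 [k1 e1]]] [h2 [q2 [k2 e2]]]; exists (h1 + h2), (q1 + q2)%N.
  split; first exact: ordD.
  rewrite [iter p _ (h1 + h2)](flinD fli) addrACA (flinD fli); apply: ordD.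
    by apply: ord_iter_ge e1 _; rewrite ?leq_addr //; apply: flin_shift.
  by apply: ord_iter_ge e2 _; rewrite ?leq_addl //; apply: flin_shift.
have G_ord g' : ord k.+1 g' -> G g'.
  by move=> hg; exists 0, 0%N; split; rewrite ?(flin0 fli) ?addr0.
move=> hg; rewrite -[g](subrK (\sum_(b : box n k) g (mval b) *: mon K (mval b))).
apply: (GD); first by apply: G_ord; apply: ord_trunc.
elim/big_ind: _ => [||b _]; [exact/G_ord/ord_zero | exact: GD |].
have [bk|kb] := ltnP (mdeg (mval b)) k; first by rewrite hg // scale0r; apply: G_ord.
have [q hq] := geneigZ hD (g (mval b)) (shift_op_mon (mval b)).
have hv : ord k (g (mval b) *: mon K (mval b)) by apply: ordZ; apply: ord_le (@ord_mon _ _ _).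
have {}hq : ord k.+1 (iter q (sop (weight (mval b))) (g (mval b) *: mon K (mval b))).
  exact: ord_le hq.
have [e|ne] := eqVneq c (weight (mval b)).
  by exists 0, q; split=> //; rewrite (flin0 fli) addr0 e.
have [h [hk hh _]] := shift_op_solve_iter hD p ne hv hq.
exists (- h), 0%N; split; first exact: ordN.
by rewrite /= (flinN fli) -opprB; apply: ordN.
Qed.

(** The defect (D - c)^p f has order k and is corrected in degree k; as h has order k, the lower
    degrees of f are untouched. *)
Lemma geneig_step k c f : geneig D k c f ->
  exists h, ord k h /\ geneig D k.+1 c (f + h).
Proof.
move=> [p hp]; have [h [q [hk hq]]] := shift_op_correct c p hp.
exists h; split=> //; exists (q + p)%N; by rewrite iterD (flinD fli).
Qed.

(** The limit of the successive corrections for the topology of the powers of the maximal ideal. *)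
Lemma geneig_exists k c f : geneig D k c f ->
  exists g, ord k (g - f) /\ forall l, geneig D l c g.
Proof.
move=> hf.
(* A correction needs the property of the approximation before it, so the sequence takes its values
   in pairs of a series and a proof. *)
have step i (x : {g | geneig D (k + i) c g}) :
    {y : {g | geneig D (k + i.+1) c g} | ord (k + i) (sval y - sval x)}.
  apply: cid; case: x => g hg /=; have [h [hk hh]] := geneig_step hg.
  rewrite addnS; exists (exist _ (g + h) hh) => /=; by rewrite addrC addKr.
have hf0 : geneig D (k + 0) c f by rewrite addn0.
pose s := fix s i : {g | geneig D (k + i) c g} :=
  if i is j.+1 then sval (step j (s j)) else exist _ f hf0.
pose F i := sval (s i).
have FS i : ord (k + i) (F i.+1 - F i) by rewrite /F /=; case: (step i (s i)).
have Fle i j : (i <= j)%N -> ord (k + i) (F j - F i).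
  move=> ij; rewrite -(subnK ij); elim: (j - i)%N => [|m IH]; first by rewrite subrr.
  have -> : F (m.+1 + i)%N - F i = (F (m + i).+1 - F (m + i)%N) + (F (m + i)%N - F i).
    by rewrite addrA subrK.
  apply: ordD => //; apply: (ord_le _ (FS (m + i)%N)).
  by rewrite leq_add2l leq_addl.
(* From the index |a| + 1 on, the coefficient of z^a no longer changes. *)
pose g : fps K n := fun a => F (mdeg a).+1 a.
have gF i : ord (k + i) (g - F i).
  move=> a ai; rewrite coefB /g; have [le|lt] := leqP i (mdeg a).+1.
    by have := Fle _ _ le a ai.
  apply/eqP; rewrite subr_eq0 eq_sym; apply/eqP.
  by apply: (ord_eq (Fle _ _ (ltnW lt))); rewrite addnS ltnS leq_addl.
exists g; split=> [|l]; first by have := gF 0%N; rewrite addn0.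
suff [p hp] : geneig D (k + l) c g by exists p; apply: ord_le hp; rewrite leq_addl.
rewrite -[g](subrK (F l)); apply: (geneigD hD); last by rewrite /F; case: (s l).
exact: geneig_ord.
Qed.

End Approximate.

Section Exact.
Hypothesis hz : forall k j, geneig D k (gam j) (fps_var j).

Lemma geneig_mon k b : geneig D k (weight b) (mon K b).
Proof.
elim/mindex_ind: b => [|j b [q hq]].
  exists 1%N; rewrite /= mon0 /shift_op (fder1 (fhom_id _ _) hD) weight0.
  by rewrite scale0r subrr.
have [p hp] := hz k j; exists (p + q)%N; rewrite monM mon_delta weightD weight_delta.
apply: (nilpotent_mul fl fl fl (shift_op_mul _ _) (@ord0r _ _ _) (@ord0r _ _ _) hp hq).
  by rewrite addn0.
by [].
Qed.

Definition shift_ops (l : seq K) v := foldr sop v l.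

Lemma flin_shift_ops l : flin (shift_ops l).
Proof.
elim: l => [|c l IH]; first exact: flin_id.
exact: flin_comp (flin_shift hD c) IH.
Qed.

Lemma shift_opsC l1 l2 v : shift_ops l1 (shift_ops l2 v) = shift_ops l2 (shift_ops l1 v).
Proof.
elim: l1 => //= c l1 ->; move: (shift_ops l1 v) => w.
by elim: l2 => //= d l2 <-; rewrite shift_opC.
Qed.

(** Distinct generalized eigenspaces are independent: if w is generalized for c and D w = d w modulo
    order k, then (D - c)^p w = (d - c)^p w there, and the left side vanishes for p large. *)
Lemma geneig_killed k c l v : geneig D k c v -> c \notin l -> ord k (shift_ops l v) -> ord k v.
Proof.
move=> hv; elim: l => //= d l IH; rewrite inE negb_or => /andP [cd cl] hd.
apply: IH => //; move: hd; set w := shift_ops l v => hd.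
have [p hp] : geneig D k c w.
  have DL g : D (shift_ops l g) = shift_ops l (D g).
    elim: {cl w hd} l g => //= d' l IH g.
    by rewrite -IH /shift_op (flinB hD.1) (flinZ hD.1).
  exact: (geneig_intertwine (flin_shift_ops l) DL hv).
have e m : ord k (iter m (sop c) w - (d - c) ^+ m *: w).
  elim: m => [|m IHm]; first by rewrite expr0 scale1r subrr.
  have -> : iter m.+1 (sop c) w - (d - c) ^+ m.+1 *: w =
      sop c (iter m (sop c) w - (d - c) ^+ m *: w) + (d - c) ^+ m *: (sop c w - (d - c) *: w).
    by rewrite (flinB fl) (flinZ fl) [_ *: (sop c w - _)]scalerBr addrA subrK scalerA -exprSr.
  apply: ordD; first exact: (flin_ord fl IHm).
  have -> : sop c w - (d - c) *: w = sop d w; last exact: ordZ.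
  by rewrite /shift_op scalerBl opprB addrA subrK.
have dc0 : (d - c) ^+ p != 0 by rewrite expf_neq0 // subr_eq0 eq_sym.
rewrite -[w](scalerK dc0); apply: ordZ.
by rewrite -[_ *: w](subKr (iter p (sop c) w)); apply: ordB.
Qed.

(** Up to degree |a|, F is the sum of its part r of weight c and of the rest s. As F - r, the series
    s is generalized for c; as a sum of monomials of other weights, it is killed by a product of
    operators D - d with d <> c. Hence s vanishes. *)
Lemma geneig_weight c F : (forall k, geneig D k c F) -> forall a, F a != 0 -> c = weight a.
Proof.
move=> hF a; apply: contra_neq_eq => ca; pose N := mdeg a.
pose r : fps K n := \sum_(b : box n N | weight (mval b) == c) F (mval b) *: mon K (mval b).
pose s : fps K n := \sum_(b : box n N | weight (mval b) != c) F (mval b) *: mon K (mval b).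
have Frs : ord N.+1 (F - (r + s)).
  have -> : r + s = \sum_(b : box n N) F (mval b) *: mon K (mval b); last exact: ord_trunc.
  by rewrite [RHS](bigID (fun b : box n N => weight (mval b) == c)).
have hs : geneig D N.+1 c s.
  have -> : s = F - (F - (r + s)) - r by rewrite subKr addrC addKr.
  apply: (geneigB hD); first by apply: (geneigB hD) => //; apply: geneig_ord.
  by apply: (geneig_sum hD) => b /eqP <-; apply: (geneigZ hD); apply: geneig_mon.
have [l [cl hl]] : exists l, c \notin l /\ ord N.+1 (shift_ops l s).
  rewrite /s; elim/big_ind: _ => [|u v [l1 [c1 h1]] [l2 [c2 h2]]|b bc].
  - by exists [::].
  - exists (l1 ++ l2); rewrite mem_cat negb_or c1 c2; split=> //.
    have -> w : shift_ops (l1 ++ l2) w = shift_ops l1 (shift_ops l2 w) by rewrite /shift_ops foldr_cat.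
    have [f1 f2] := (flin_shift_ops l1, flin_shift_ops l2).
    rewrite (flinD f2) (flinD f1) shift_opsC; apply: ordD; last exact: flin_ord h2.
    exact: flin_ord h1.
  have [p hp] := geneig_mon N.+1 (mval b); exists (nseq p (weight (mval b))); split.
    by rewrite mem_nseq eq_sym (negbTE bc) andbF.
  rewrite (flinZ (flin_shift_ops _)); apply: ordZ.
  suff -> : shift_ops (nseq p (weight (mval b))) (mon K (mval b)) =
    iter p (sop (weight (mval b))) (mon K (mval b)) by [].
  by elim: p {hp} => //= p ->.
have sN := geneig_killed hs cl hl.
rewrite (ord_eq Frs) // coefD (sN a) // addr0 /r coef_sum big1 // => b /eqP bc.
rewrite coefZ /mon; case: eqP => [e|]; last by rewrite mulr0.
by case/eqP: ca; rewrite e.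
Qed.

End Exact.
End Weights.

(** * Exponentials of filtered operators *)

Section FieldSeries.
Local Open Scope classical_set_scope.
Local Open Scope ring_scope.
Variable C : numFieldType.
Implicit Types (u v x y : nat -> C) (l : C).

Definition sercvg u (l : C) : Prop := series (u : nat -> C^o) @ \oo --> (l : C^o).

Lemma sercvg_uniq u l l' : sercvg u l -> sercvg u l' -> l = l'.
Proof. exact: (@cvg_unique _ (@norm_hausdorff C C^o) _ _ (l : C^o) (l' : C^o)). Qed.

Lemma sercvg_ext u v l : u =1 v -> sercvg u l -> sercvg v l.
Proof. by move=> /funext ->. Qed.

Lemma sercvg0 : sercvg (fun=> 0) 0.
Proof.
rewrite /sercvg; have -> : series (fun=> 0 : C^o) = (fun=> 0).
  by apply/funext => N; rewrite /series /= big1.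
exact: cvg_cst.
Qed.

Lemma sercvgD u v l l' : sercvg u l -> sercvg v l' -> sercvg (fun m => u m + v m) (l + l').
Proof.
move=> hu hv; rewrite /sercvg.
have -> : series ((fun m => u m + v m) : nat -> C^o) = (series (u : nat -> C^o) \+ series (v : nat -> C^o))%R.
  by apply/funext => N; rewrite /series /= big_split.
by apply: cvgD.
Qed.

Lemma sercvgZ c u l : sercvg u l -> sercvg (fun m => c * u m) (c * l).
Proof.
move=> hu; rewrite /sercvg.
have -> : series ((fun m => c * u m) : nat -> C^o) = (fun N => c * series (u : nat -> C^o) N).
  by apply/funext => N; rewrite /series /= mulr_sumr.
by apply: cvgMl_tmp.
Qed.

Lemma sercvg_sum I (r : seq I) (P : pred I) (u : I -> nat -> C) (l : I -> C) :
  (forall i, P i -> sercvg (u i) (l i)) ->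
  sercvg (fun m => \sum_(i <- r | P i) u i m) (\sum_(i <- r | P i) l i).
Proof.
move=> h; elim: r => [|i r IH].
  rewrite big_nil; apply: sercvg_ext sercvg0 => m; by rewrite big_nil.
rewrite big_cons; case: ifPn => Pi.
  by apply: sercvg_ext (sercvgD (h i Pi) IH) => m; rewrite big_cons Pi.
by apply: sercvg_ext IH => m; rewrite big_cons (negbTE Pi).
Qed.

Lemma sercvg_finite u p : (forall m, (p <= m)%N -> u m = 0) -> sercvg u (\sum_(m < p) u m).
Proof.
move=> h; apply: cvg_near_cst; exists p => // N /= pN.
rewrite /series /= (big_cat_nat (leq0n p) pN) /= big_mkord [X in _ + X]big_nat [X in _ + X]big1 ?addr0 //.
by move=> i /andP [pi _]; apply: h.
Qed.

Lemma sercvg_mulB u v w (e : nat -> C) l l' : sercvg u l -> sercvg v l' ->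
  (e : nat -> C^o) @ \oo --> (0 : C^o) ->
  (forall N, series (w : nat -> C^o) N = series (u : nat -> C^o) N * series (v : nat -> C^o) N - e N) ->
  sercvg w (l * l').
Proof.
move=> hu hv he /funext ew; rewrite /sercvg ew -[l * l']subr0.
by apply: cvgB => //; apply: cvgM.
Qed.

End FieldSeries.

Section ComplexSeries.
Local Open Scope classical_set_scope.
Local Open Scope ring_scope.
Variable R : realType.
Local Notation C := (R[i]).
Implicit Types (x y : nat -> C).

Lemma cvg_norm_le (e : nat -> C) (t : nat -> R) : (forall N, `|e N| <= (t N)%:C%C) ->
  t @ \oo --> (0 : R) -> (e : nat -> C^o) @ \oo --> (0 : C^o).
Proof.
move=> et t0; apply/cvgr0Pnorm_lt => eps; rewrite ltcE => /andP [/eqP /= Im0 Re0].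
move/cvgr0Pnorm_lt: t0 => /(_ _ Re0); apply: filterS => N tN.
apply: le_lt_trans (et N) _.
rewrite ltcE /= Im0 eqxx /=; apply: le_lt_trans tN; exact: ler_norm.
Qed.

(** The form of absolute convergence used here; every coefficient of exp(L) f has it, by
    [exp_term_dominated]. *)
Definition exp_dominated (u : nat -> C) := exists c r : R, [/\ 0 <= c, 0 <= r &
  forall m, `|u m| <= (c * (r ^+ m / m`!%:R))%:C%C].

(* The dominating series are those of e^r and e^s, for which the error term of
   the Cauchy product is known to vanish since e^r e^s = e^(r + s). *)
Lemma exp_series_cauchy (r s : R) :
  (fun N => \sum_(i < N) \sum_(j < N | (N <= i + j)%N)
     (r ^+ i / i`!%:R) * (s ^+ j / j`!%:R)) @ \oo --> (0 : R).
Proof.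
pose S (w : R) N := series (exp_coeff w) N : R.
have SE (w : R) : S w @ \oo --> expR w by exact: is_cvg_series_exp_coeff.
have -> : (fun N => \sum_(i < N) \sum_(j < N | (N <= i + j)%N)
     (r ^+ i / i`!%:R) * (s ^+ j / j`!%:R)) = (fun N => S r N * S s N - S (r + s) N).
  apply/funext => N; rewrite /S !seriesEord /exp_coeff /=.
  rewrite mulr_suml; apply/esym/eqP; rewrite subr_eq; apply/eqP.
  pose F i j : R := (r ^+ i / i`!%:R) * (s ^+ j / j`!%:R).
  transitivity (\sum_(i < N) \sum_(j < N) F i j).
    by apply: eq_bigr => i _; rewrite mulr_sumr.
  have -> : \sum_(m < N) (r + s) ^+ m / m`!%:R = \sum_(i < N) \sum_(j < N | (i + j < N)%N) F i j.
    rewrite -sum_triangle; apply: eq_bigr => m _; rewrite addrC exprDn mulr_suml.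
    apply: eq_bigr => i _; have im : (i <= m)%N by rewrite -ltnS.
    rewrite -mulr_natr -(bin_fact im) !natrM /F.
    have fact_neq0 k : k`!%:R != 0 :> R by rewrite pnatr_eq0 -lt0n fact_gt0.
    have c0 : 'C(m, i)%:R != 0 :> R by rewrite pnatr_eq0 -lt0n bin_gt0.
    by field; rewrite c0 !fact_neq0.
  rewrite -big_split /=; apply: eq_bigr => i _.
  rewrite (bigID (fun j : 'I_N => (N <= i + j)%N)) /=; congr (_ + _).
  by apply: eq_bigl => j; rewrite -ltnNge.
have -> : 0 = expR r * expR s - expR (r + s) by rewrite expRD subrr.
by apply: cvgB; [apply: cvgM|].
Qed.

(** The product of the partial sums exceeds that of the Cauchy product by the terms with i, j < N <=
    i + j, which are dominated by the same terms for e^r e^s. *)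
Lemma sercvg_cauchy_product x y X Y : exp_dominated x -> exp_dominated y ->
  sercvg x X -> sercvg y Y ->
  sercvg (fun m => \sum_(i < m.+1) x i * y (m - i)%N) (X * Y).
Proof.
move=> [c [r [c0 r0 hx]]] [d [s [d0 s0 hy]]] xX yY.
pose e N := \sum_(i < N) \sum_(j < N | (N <= i + j)%N) x i * y j.
have e0 : (e : nat -> C^o) @ \oo --> (0 : C^o).
  apply: (@cvg_norm_le _ (fun N => (c * d) * (\sum_(i < N) \sum_(j < N | (N <= i + j)%N)
     (r ^+ i / i`!%:R) * (s ^+ j / j`!%:R)))) => [N|].
    rewrite /e mulr_sumr raddf_sum; apply: le_trans (ler_norm_sum _ _ _) _.
    apply: ler_sum => i _; rewrite mulr_sumr raddf_sum.
    apply: le_trans (ler_norm_sum _ _ _) _; apply: ler_sum => j _.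
    rewrite normrM; apply: le_trans (ler_pM _ _ (hx i) (hy j)) _ => //.
    by rewrite -rmorphM /= lecR mulrACA.
  rewrite -[X in _ --> X](mulr0 (c * d)); apply: cvgMl_tmp; exact: exp_series_cauchy.
apply: (sercvg_mulB xX yY e0) => N.
rewrite !seriesEord /= (sum_triangle N (fun i j => x i * y j)).
rewrite mulr_suml /e -sumrB; apply: eq_bigr => i _.
rewrite mulr_sumr [X in _ = X - _](bigID (fun j : 'I_N => (N <= i + j)%N)) /= addrAC subrr add0r.
by apply: eq_bigl => j; rewrite -ltnNge.
Qed.

End ComplexSeries.

Section Binomial.
Variables (K : numFieldType) (n : nat).
Implicit Types (f g : fps K n) (L D : fps K n -> fps K n).

Lemma coefMn f k a : (f *+ k) a = f a *+ k.
Proof. by elim: k => // k IH; rewrite !mulrS coefD IH. Qed.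

Lemma flinMn L f k : flin L -> L (f *+ k) = L f *+ k.
Proof. by move=> hL; elim: k => [|k IH]; rewrite ?(flin0 hL) // !mulrS (flinD hL) IH. Qed.

Lemma bin_fact_div m i : (i <= m)%N ->
  'C(m, i)%:R / m`!%:R = (i`!%:R)^-1 * ((m - i)`!%:R)^-1 :> K.
Proof.
move=> im; rewrite -(bin_fact im) !natrM.
have fact_neq0 k : k`!%:R != 0 :> K by rewrite pnatr_eq0 -lt0n fact_gt0.
have c0 : 'C(m, i)%:R != 0 :> K by rewrite pnatr_eq0 -lt0n bin_gt0.
by field; rewrite c0 !fact_neq0.
Qed.

Lemma iter_der_mul D m f g : fder id D ->
  iter m D (f * g) = \sum_(i < m.+1) (iter i D f * iter (m - i) D g) *+ 'C(m, i).
Proof.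
move=> [hD DM]; elim: m => [|m IH]; first by rewrite big_ord1 bin0.
rewrite (sum_pascal m (fun i => iter i D f * iter (m.+1 - i) D g)) iterS IH (flin_sum hD).
rewrite -big_split; apply: eq_bigr => i _ /=.
rewrite (flinMn _ _ hD) DM ?subSS mulrnDl addrC; congr (_ *+ _ + _).
by rewrite subSn // -ltnS.
Qed.

Lemma iter_add_comm L1 L2 m f : flin L1 -> flin L2 -> (forall g, L1 (L2 g) = L2 (L1 g)) ->
  iter m (fun g => L1 g + L2 g) f = \sum_(i < m.+1) iter i L1 (iter (m - i) L2 f) *+ 'C(m, i).
Proof.
move=> h1 h2 c; have c' i g : L2 (iter i L1 g) = iter i L1 (L2 g).
  by elim: i => //= i <-; rewrite c.
elim: m => [|m IH]; first by rewrite big_ord1 bin0.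
rewrite (sum_pascal m (fun i => iter i L1 (iter (m.+1 - i) L2 f))) iterS IH.
rewrite (flin_sum h1) (flin_sum h2) addrC -!big_split; apply: eq_bigr => i _ /=.
rewrite (flinMn _ _ h1) (flinMn _ _ h2) ?subSS c'; congr (_ *+ _ + _).
by rewrite subSn // -ltnS.
Qed.

End Binomial.

Section Exps.
Variables (R : realType) (n : nat).
Local Notation C := (R[i]).
Implicit Types (f g h : fps C n) (L D : fps C n -> fps C n).

Definition exp_term L f a : nat -> C := fun m => iter m L f a / m`!%:R.

Definition exps L f g := forall a, sercvg (exp_term L f a) (g a).

(** A bound for the norm of L on jets of degree at most N: L does not lower the order, so those
    coefficients of L f depend only on those of f. The constant is the sum of the moduli of the
    matrix entries. *)
Lemma flin_bound L N : flin L -> exists2 r : R, 0 <= r & forall f (c : R),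
  (forall a, (mdeg a <= N)%N -> `|f a| <= c%:C%C) ->
  forall a, (mdeg a <= N)%N -> `|L f a| <= (r * c)%:C%C.
Proof.
(* The modulus on R[i] has its values in R[i]; [nr] is the same number in R. *)
move=> hL; pose nr (x : C) : R := complex.Re `|x|.
have nrE x : (nr x)%:C%C = `|x| by apply/RRe_real/normr_real.
have nr0 x : 0 <= nr x by rewrite -lecR nrE; apply: normr_ge0.
exists (\sum_(a : box n N) \sum_(b : box n N) nr (L (mon C (mval b)) (mval a))).
  by apply: sumr_ge0 => a _; apply: sumr_ge0.
move=> f c hf a aN; have c0 : 0 <= c by rewrite -lecR; apply: le_trans (normr_ge0 _) (hf a aN).
rewrite (flin_coef hL _ aN); apply: le_trans (ler_norm_sum _ _ _) _.
apply: (@le_trans _ _ ((\sum_(b : box n N) nr (L (mon C (mval b)) a)) * c)%:C%C).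
  rewrite mulr_suml raddf_sum; apply: ler_sum => b _.
  rewrite normrM [leRHS]rmorphM /= nrE mulrC.
  have [bN|Nb] := leqP (mdeg (mval b)) N; first by apply: ler_wpM2l => //; apply: hf.
  have -> : L (mon C (mval b)) a = 0; last by rewrite normr0 !mul0r.
  by apply: (flin_ord hL (@ord_mon _ _ _)); apply: leq_ltn_trans Nb.
rewrite lecR; apply: ler_wpM2r => //.
rewrite [leRHS](bigD1 (mbox N a)) //= mboxK_deg // lerDl.
by apply: sumr_ge0 => b _; apply: sumr_ge0.
Qed.

Lemma exp_term_dominated L f a : flin L -> exp_dominated (exp_term L f a).
Proof.
move=> hL; pose N := mdeg a; have [r r0 hr] := flin_bound N hL.
pose nr (x : C) : R := complex.Re `|x|.
have nrE x : (nr x)%:C%C = `|x| by apply/RRe_real/normr_real.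
have nr0 x : 0 <= nr x by rewrite -lecR nrE; apply: normr_ge0.
pose c := \sum_(b : box n N) nr (f (mval b)).
have hf b : (mdeg b <= N)%N -> `|f b| <= c%:C%C.
  move=> bN; rewrite -nrE lecR /c (bigD1 (mbox N b)) //= mboxK_deg // lerDl.
  by apply: sumr_ge0.
exists c, r; split=> // [|m]; first exact: sumr_ge0.
have hm b : (mdeg b <= N)%N -> `|iter m L f b| <= (r ^+ m * c)%:C%C.
  elim: m b => [|m IH] b bN; first by rewrite expr0 mul1r; apply: hf.
  by rewrite iterS exprS -mulrA; apply: hr.
have m0 : 0 < (m`!%:R : R) by rewrite ltr0n fact_gt0.
rewrite /exp_term normrM mulrA rmorphM /= mulrC [leRHS]mulrC.
have -> : (m`!%:R^-1)%:C%C = `|(m`!%:R : C)^-1|.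
  by rewrite normfV normr_nat fmorphV /= rmorph_nat.
by apply: ler_wpM2l => //; rewrite mulrC; apply: hm.
Qed.

Lemma exps_uniq L f g g' : exps L f g -> exps L f g' -> g = g'.
Proof. by move=> h h'; apply/funext => a; apply: sercvg_uniq (h a) (h' a). Qed.

Lemma exps_monP L E : flin L -> flin E -> (forall b, exps L (mon C b) (E (mon C b))) ->
  forall f, exps L f (E f).
Proof.
move=> hL hE h f a; rewrite (flin_coef hE _ (leqnn _)).
have hs := sercvg_sum (r := index_enum (box n (mdeg a))) (P := xpredT)
  (fun b (_ : xpredT b) => sercvgZ (c := f (mval b)) (h (mval b) a)).
apply: sercvg_ext hs => m /=.
rewrite /exp_term (flin_coef (flin_iter m hL) _ (leqnn _)) mulr_suml.
by apply: eq_bigr => b _; rewrite mulrA.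
Qed.

Lemma exps_flin L A f g : flin L -> flin A -> (forall h, L (A h) = A (L h)) ->
  exps L f g -> exps L (A f) (A g).
Proof.
move=> hL hA LA h a; rewrite (flin_coef hA _ (leqnn _)).
have hs := sercvg_sum (r := index_enum (box n (mdeg a))) (P := xpredT)
  (fun b (_ : xpredT b) => sercvgZ (c := A (mon C (mval b)) a) (h (mval b))).
under eq_bigr do rewrite mulrC; apply: sercvg_ext hs => m /=.
have e : iter m L (A f) = A (iter m L f) by elim: m => //= m ->.
rewrite /exp_term e (flin_coef hA _ (leqnn _)) mulr_suml.
by apply: eq_bigr => b _; rewrite mulrCA mulrA.
Qed.

Lemma exps_conj L A A' f g : flin L -> flin A -> cancel A A' ->
  exps L (A' f) g -> A (A' f) = f -> exps (fun h => A (L (A' h))) f (A g).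
Proof.
move=> hL hA AK h AA' a; rewrite (flin_coef hA _ (leqnn _)).
have hs := sercvg_sum (r := index_enum (box n (mdeg a))) (P := xpredT)
  (fun b (_ : xpredT b) => sercvgZ (c := A (mon C (mval b)) a) (h (mval b))).
under eq_bigr do rewrite mulrC; apply: sercvg_ext hs => m /=.
have e : iter m (fun h => A (L (A' h))) f = A (iter m L (A' f)).
  by elim: m => [|m IH]; rewrite ?AA' // iterS IH AK.
rewrite /exp_term e (flin_coef hA _ (leqnn _)) mulr_suml.
by apply: eq_bigr => b _; rewrite mulrCA mulrA.
Qed.

(** The exponential of a derivation is multiplicative: the Leibniz formula for D^m (f g) / m! is a
    Cauchy product in each pair of coefficients. *)
Lemma exps_mul D f g f' g' : fder id D -> exps D f f' -> exps D g g' ->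
  exps D (f * g) (f' * g').
Proof.
move=> dD hf hg a; rewrite (fps_coefM _ _ (leqnn _)).
have dom f b := exp_term_dominated f b dD.1.
have hs := sercvg_sum (r := index_enum (box n (mdeg a))) (P := xpredT)
  (fun b (_ : xpredT b) => sercvg_sum (r := index_enum (box n (mdeg a)))
    (P := fun c => mval b + mval c == a)
    (fun c _ => sercvg_cauchy_product (dom f (mval b)) (dom g (mval c)) (hf (mval b)) (hg (mval c)))).
apply: sercvg_ext hs => m /=.
rewrite /exp_term iter_der_mul // coef_sum mulr_suml.
under [RHS]eq_bigr => i _.
  rewrite coefMn -[X in X / _]mulr_natr -mulrA bin_fact_div -1?ltnS // (fps_coefM _ _ (leqnn _)).
  rewrite mulr_suml; under eq_bigr do rewrite mulr_suml; over.
under eq_bigr do rewrite exchange_big /=.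
rewrite exchange_big /=; apply: eq_bigr => i _; apply: eq_bigr => b _; apply: eq_bigr => c _.
by rewrite mulrACA.
Qed.

Lemma exps1 D : fder id D -> exps D 1 1.
Proof.
move=> dD a; have D1 := fder1 (fhom_id _ _) dD.
have h m : (1 <= m)%N -> exp_term D 1 a m = 0.
  case: m => // m _; rewrite /exp_term iterSr D1.
  by rewrite (flin0 (flin_iter m dD.1)) mul0r.
have := sercvg_finite h; by rewrite big_ord1 /exp_term fact0 divr1.
Qed.

(** By multiplicativity and continuity, a map phi that is exp(D) on the variables gives exp(D) on
    every series, as f |-> f o phi. *)
Lemma exps_comp D phi : fder id D -> formal_vfield phi ->
  (forall k, exps D (fps_var k) (phi k)) -> forall f, exps D f (fps_comp f phi).
Proof.
move=> dD hphi h; have [hl hl1 hlM] := fps_comp_hom hphi.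
apply: (exps_monP dD.1 hl); elim/mindex_ind => [|j b IH].
  by rewrite mon0 hl1; apply: exps1.
have -> : fps_comp (mon C (mdelta j + b)) phi = phi j * fps_comp (mon C b) phi.
  by rewrite monM mon_delta -(fps_comp_var hphi j); apply: hlM.
rewrite monM mon_delta; exact: (exps_mul dD (h j) IH).
Qed.

(** This is e^(L1 + L2) = e^L1 e^L2 for commuting operators. The exponential of L1 is needed on all
    series, as it is applied to the limit g; that of L2 only at f. *)
Lemma exps_add L1 L2 E f g : flin L1 -> flin L2 -> flin E ->
  (forall h, L1 (L2 h) = L2 (L1 h)) -> (forall h, exps L1 h (E h)) -> exps L2 f g ->
  exps (fun h => L1 h + L2 h) f (E g).
Proof.
move=> h1 h2 hE c hL1 hL2 a; rewrite (flin_coef hE _ (leqnn _)).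
have hs := sercvg_sum (r := index_enum (box n (mdeg a))) (P := xpredT)
  (fun b (_ : xpredT b) => sercvg_cauchy_product (exp_term_dominated (mon C (mval b)) a h1)
     (exp_term_dominated f (mval b) h2) (hL1 (mon C (mval b)) a) (hL2 (mval b))).
under eq_bigr do rewrite mulrC; apply: sercvg_ext hs => m /=.
rewrite /exp_term iter_add_comm // coef_sum mulr_suml.
under [RHS]eq_bigr => i _.
  rewrite coefMn -[X in X / _]mulr_natr -mulrA bin_fact_div -1?ltnS //.
  rewrite (flin_coef (flin_iter i h1) _ (leqnn _)) mulr_suml; over.
rewrite exchange_big /=; apply: eq_bigr => i _; apply: eq_bigr => b _.
by rewrite mulrACA; congr (_ * _); apply: mulrC.
Qed.

Lemma exps_finite L f p a : (forall i, (p <= i)%N -> iter i L f a = 0) ->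
  sercvg (exp_term L f a) (\sum_(i < p) iter i L f a / i`!%:R).
Proof. by move=> h; apply: sercvg_finite => m pm; rewrite /exp_term h // mul0r. Qed.

Lemma is_exp_vfieldP X phi : is_exp_vfield X phi <->
  forall k, exps (vfield_act X) (fps_var k) (phi k).
Proof. by []. Qed.

End Exps.

(** * From an exponential to a strongly resonant map *)

Section Normalization.
Variables (R : realType) (n : nat).
Local Notation C := (R[i]).
Implicit Types (f g : fps C n) (L : fps C n -> fps C n) (eta theta phi X : formal_map C n).

(** Both sides are the sum of the series exp(D) (D f). *)
Lemma exps_commute D phi f : fder id D -> formal_vfield phi ->
  (forall k, exps D (fps_var k) (phi k)) -> D (fps_comp f phi) = fps_comp (D f) phi.
Proof.
move=> dD hphi h; have hc := exps_comp dD hphi h.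
apply: (exps_uniq (L := D) (f := D f)); last exact: hc.
exact: (exps_flin dD.1 dD.1 (fun=> erefl) (hc f)).
Qed.

(* The column eta consists of generalized eigenvectors in the coordinates w if
   and only if this operator, which is real when D and S are, is nilpotent on
   it modulo each degree. *)
Definition twist_op (D : fps C n -> fps C n) (S : 'M[C]_n) eta : formal_map C n :=
  fun i => D (eta i) - mxact S eta i.

Section WithLinearPart.
Variables (S N B P : 'M[C]_n) (gam : 'I_n -> C) (p : nat).
Hypotheses (uP : P \in unitmx) (SP : S *m P = P *m diag_mx (\row_k gam k)).
Hypotheses (BSN : B = S + N) (SN : S *m N = N *m S) (Np : N ^+ p = 0).

Let Q := invmx P.
Let QP : Q *m P = 1%:M := mulVmx uP.
Let PQ : P *m Q = 1%:M := mulmxV uP.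

Lemma invP_S : Q *m S = diag_mx (\row_k gam k) *m Q.
Proof. by rewrite -[Q *m S]mulmx1 -PQ -!mulmxA (mulmxA S) SP !mulmxA QP mul1mx. Qed.

(** In the coordinates w, S is diagonal and the coupled system separates into the operators D -
    gam_j. *)
Lemma twist_op_mxact D eta m : flin D -> iter m (twist_op D S) (mxact P eta) =
  mxact P (fun j => iter m (shift_op D (gam j)) (eta j)).
Proof.
move=> hD; elim: m => // m IH; rewrite iterS IH; apply/funext => i.
rewrite /twist_op (flin_mxact _ _ _ hD) -mxactM SP mxactM -sumrB.
by apply: eq_bigr => k _; rewrite mxact_diag mxE -scalerBr.
Qed.

Section Forward.
Variables (X : formal_map C n) (hX : formal_vfield X) (jX : jet1 X = B).
Let D := vfield_act X.
Let dD : fder id D := vfield_act_der hX.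

Let A f := fps_comp f (linear_formal_map P).
Let A' f := fps_comp f (linear_formal_map Q).
Let hA : fhom A := fps_comp_hom (linear_formal_vfield P).
Let hA' : fhom A' := fps_comp_hom (linear_formal_vfield Q).
Let AK : cancel A A' := fps_comp_linK PQ.
Let A'K : cancel A' A := fps_comp_linK QP.

(** Row j of Q is the linear form w_j, a left eigenvector of S for gam_j. As N commutes with S, so
    are its images under powers of N, and B - gam_j acts on them as N. *)
Lemma row_shift j m : row j Q *m (B - (gam j)%:M) ^+ m = row j Q *m N ^+ m.
Proof.
elim: m => [|m IH]; first by rewrite !expr0.
rewrite exprSr -mulmxE mulmxA IH BSN mulmxBr mulmxDr mul_mx_scalar.
have -> : row j Q *m N ^+ m *m S = gam j *: (row j Q *m N ^+ m).
  have c : N ^+ m *m S = S *m N ^+ m.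
    by rewrite mulmxE; apply/esym/commrX; rewrite /GRing.comm -!mulmxE.
  by rewrite -mulmxA c mulmxA -row_mul invP_S row_mul row_diag_mx -!scalemxAl -rowE mxE.
by rewrite addrAC subrr add0r exprSr -mulmxE mulmxA.
Qed.

Lemma geneig_linear j : geneig D 2 (gam j) (A' (fps_var j)).
Proof.
exists p; have hs := flin_shift dD (gam j).
have -> : A' (fps_var j) = linform (row j Q).
  by rewrite /A' fps_comp_var ?linear_formal_mapE //; apply: linear_formal_vfield.
apply: ord2_jetr0; first by apply: ord_iter => //; apply: ord_linform.
rewrite jetr_iter //; last exact: ord_linform.
have -> : jet1 (fun k => shift_op D (gam j) (fps_var k)) = B - (gam j)%:M.
  apply/matrixP => i k; rewrite -jX !mxE /shift_op coefB coefZ /D vfield_act_var.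
  by rewrite /fps_var mdelta_inj eq_sym mulr_natr.
by rewrite jetr_linform row_shift Np mulmx0.
Qed.

Lemma exists_twist_nilpotent : exists theta, tangent_id theta /\
  forall k, exists m, forall i, ord k (iter m (twist_op D S) theta i).
Proof.
(* [D'] is D read in the coordinates w, where the variables are generalized eigenvectors modulo
   order 2. *)
pose D' f := A (D (A' f)).
have dD' : fder id D' by apply: (fder_conj hA hA' A'K dD).
have hz j : geneig D' 2 (gam j) (fps_var j).
  have DA g : D' (A g) = A (D g) by rewrite /D' AK.
  rewrite -[fps_var j]A'K; have hl : flin A by case: hA.
  exact: (geneig_intertwine hl DA (geneig_linear j)).
have /choice [G hG] j : exists g, ord 2 (g - fps_var j) /\ forall l, geneig D' l (gam j) g.
  exact: (geneig_exists dD' hz (hz j)).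
pose Th j := A' (G j).
have hTh l j : geneig D l (gam j) (Th j).
  have DA' g : D (A' g) = A' (D' g) by rewrite /D' AK.
  have hl : flin A' by case: hA'.
  exact: (geneig_intertwine hl DA' ((hG j).2 l)).
(* [Th] is tangent to w = Q z; applying P makes it tangent to the identity in z. *)
exists (mxact P Th); split=> [i|k].
  have -> : mxact P Th i - fps_var i = mxact P (fun j => A' (G j - fps_var j)) i.
    have -> : fps_var i = mxact P (fun j => A' (fps_var j)) i :> fps C n.
      have -> : (fun j => A' (fps_var j)) = mxact Q formal_map_id.
        apply/funext => j; rewrite /A' fps_comp_var -?linear_formal_mxact //.
        exact: linear_formal_vfield.
      by rewrite -mxactM PQ mxact1.
    by rewrite -sumrB; apply: eq_bigr => j _; rewrite -scalerBr;
      rewrite -(flinB (fps_comp_flin (linear_formal_vfield Q))).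
  by apply: ord_sum => j _; apply: ordZ;
    apply: (flin_ord (fps_comp_flin (linear_formal_vfield Q))); exact: (hG j).1.
have [m hm] : exists m, forall j : 'I_n, ord k (iter m (shift_op D (gam j)) (Th j)).
  apply: exists_bound => [j q r|j]; last exact: hTh.
  by apply: ord_iter_ge; apply: flin_shift.
exists m => i; rewrite twist_op_mxact; last exact: dD.1.
by apply: ord_sum => j _; apply: ordZ.
Qed.

(** Taking real parts of coefficients is only linear over the reals, but it commutes with
    multiplication by the real coefficients of X and S. *)
Lemma re_twist theta : real_formal_map X -> real_mx S ->
  let re (f : fps C n) : fps C n := fun a => (complex.Re (f a))%:C%C in
  forall m, iter m (twist_op D S) (fun j => re (theta j)) = fun j => re (iter m (twist_op D S) theta j).
Proof.
move=> rX rS re.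
have reD f g : re (f + g) = re f + re g.
  by apply/funext => a; rewrite /re !coefD -rmorphD /= raddfD.
have reN f : re (- f) = - re f.
  by apply/funext => a; rewrite /re !coefN -rmorphN /= raddfN.
have re_sum I (r : seq I) (F : I -> fps C n) : re (\sum_(i <- r) F i) = \sum_(i <- r) re (F i).
  apply: (big_morph re reD); apply/funext => a; by rewrite /re coef0 /=.
have Re_mul (x y : C) : x \is Num.real -> (complex.Re (x * y))%:C%C = x * (complex.Re y)%:C%C.
  by move=> /complex_realP [r ->]; case: y => y1 y2; simpc.
have reZ x f : x \is Num.real -> re (x *: f) = x *: re f.
  by move=> hx; apply/funext => a; rewrite /re !coefZ Re_mul.
have reM f g : (forall a, f a \is Num.real) -> re (f * g) = f * re g.
  move=> hf; apply/funext => a; rewrite /re !(fps_coefM _ _ (leqnn _)).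
  rewrite raddf_sum rmorph_sum; apply: eq_bigr => b _ /=.
  rewrite raddf_sum rmorph_sum; apply: eq_bigr => c _ /=; exact: Re_mul.
have re_deriv j f : re (fps_deriv j f) = fps_deriv j (re f).
  by apply/funext => a; rewrite /re /fps_deriv Re_mul // realn.
have reT th : twist_op D S (fun j => re (th j)) = fun j => re (twist_op D S th j).
  apply/funext => j; rewrite /twist_op reD reN /mxact re_sum; congr (_ - _).
    rewrite /D !vfield_actE re_sum; apply: eq_bigr => k _.
    by rewrite reM ?re_deriv //; apply: rX.
  by apply: eq_bigr => k _; rewrite reZ.
by elim=> // m IH; rewrite iterS IH reT.
Qed.

Lemma exists_twist_nilpotent_real : exists theta, [/\ tangent_id theta,
  forall k, exists m, forall i, ord k (iter m (twist_op D S) theta i) &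
  real_formal_map X -> real_mx S -> real_formal_map theta].
Proof.
have [theta [t_theta nilp]] := exists_twist_nilpotent.
have [[rX rS]|nr] := pselect (real_formal_map X /\ real_mx S); last first.
  by exists theta; split=> // rX rS; case: nr.
exists (fun j a => (complex.Re (theta j a))%:C%C); split=> [i a a2|k|_ _ j a].
- have /(congr1 (fun x : C => (complex.Re x)%:C%C)) := t_theta i a a2.
  rewrite !coefB raddfB rmorphB /=; rewrite /fps_var.
  by case: (a == _).
- have [m hm] := nilp k; exists m => i; rewrite re_twist // => a ak.
  by rewrite hm.
by apply/complex_realP; eexists.
Qed.

Section Conclusion.
Variables (phi theta eta : formal_map C n) (h_phi : formal_vfield phi).
Hypothesis exp_phi : is_exp_vfield X phi.
Hypotheses (h_theta : formal_vfield theta) (h_eta : formal_vfield eta).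
Hypotheses (theta_eta : formal_map_comp theta eta = formal_map_id)
  (eta_theta : formal_map_comp eta theta = formal_map_id).
Hypothesis nilp_theta : forall k, exists m, forall i, ord k (iter m (twist_op D S) theta i).

Let Th := mxact Q theta.
Let H := formal_map_comp eta (linear_formal_map P).

Lemma geneig_components k j : geneig D k (gam j) (Th j).
Proof.
have [m hm] := nilp_theta k; exists m.
have -> : iter m (shift_op D (gam j)) (Th j) = mxact Q (iter m (twist_op D S) theta) j.
  have e : mxact P Th = theta by rewrite /Th -mxactM PQ mxact1.
  by rewrite -e (twist_op_mxact _ _ dD.1) -mxactM QP mxact1.
by apply: ord_sum => i _; apply: ordZ.
Qed.

Lemma strongly_resonant_conj :
  strongly_resonant gam (in_coordinates P (formal_map_comp theta (formal_map_comp phi eta))).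
Proof.
have hlP := linear_formal_vfield P.
have vTh : formal_vfield Th by apply: mxact_vfield.
have vH : formal_vfield H by apply: fps_comp_vfield.
have hTh := fps_comp_hom vTh; have hH := fps_comp_hom vH.
have mx_comp A0 (e1 e2 : formal_map C n) : formal_vfield e2 ->
    formal_map_comp (mxact A0 e1) e2 = mxact A0 (formal_map_comp e1 e2).
  by move=> hg; apply/funext => j; apply: (flin_mxact _ _ _ (fps_comp_flin hg)).
have ThH : formal_map_comp Th H = formal_map_id.
  rewrite mx_comp // -formal_map_compA // theta_eta formal_map_id_comp //.
  by rewrite linear_formal_mxact -mxactM QP mxact1.
have HTh : formal_map_comp H Th = formal_map_id.
  rewrite formal_map_compA // [X in formal_map_comp eta X]linear_comp //.
  by rewrite -mxactM PQ mxact1.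
(* [Y] is D read in the coordinates [Th]: there the variables are generalized eigenvectors in every
   degree. *)
pose Y f := fps_comp (D (fps_comp f Th)) H.
have dY : fder id Y.
  apply: (fder_conj hH hTh _ dD) => f.
  by rewrite fps_compA // ThH fps_comp_id.
have YH f : Y (fps_comp f H) = fps_comp (D f) H.
  by rewrite /Y fps_compA // HTh fps_comp_id.
have hz k j : geneig Y k (gam j) (fps_var j).
  have -> : fps_var j = fps_comp (Th j) H by have := congr1 (fun e : formal_map C n => e j) ThH.
  exact: (geneig_intertwine (fps_comp_flin vH) YH (geneig_components k j)).
(* [F] is phi in the coordinates [Th]; composition with phi commutes with D and so preserves
   generalized eigenvectors. *)
pose F j := fps_comp (fps_comp (Th j) phi) H.
have hF k j : geneig Y k (gam j) (F j).
  have Dphi g : D (fps_comp g phi) = fps_comp (D g) phi by apply: exps_commute.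
  apply: (geneig_intertwine (fps_comp_flin vH) YH).
  exact: (geneig_intertwine (fps_comp_flin h_phi) Dphi (geneig_components k j)).
suff -> : in_coordinates P (formal_map_comp theta (formal_map_comp phi eta)) = F.
  move=> j a Fa; exact: (geneig_weight dY hz (fun k => hF k j) Fa).
have vpe : formal_vfield (formal_map_comp phi eta) by apply: fps_comp_vfield.
have vpH : formal_vfield (formal_map_comp phi H) by apply: fps_comp_vfield.
rewrite /in_coordinates formal_map_compA // formal_map_compA // linear_comp; last exact: fps_comp_vfield.
rewrite -mx_comp //; apply/funext => j; rewrite /F fps_compA //.
Qed.

End Conclusion.

End Forward.
End WithLinearPart.
End Normalization.

(** * From a strongly resonant map to an exponential *)

Section MatrixFactor.
Variables (K : fieldType) (n : nat).
Implicit Types E F S : 'M[K]_n.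

Lemma mul_factorV E F F' : E \in unitmx -> F' *m F = 1%:M -> (E *m F') *m (F *m invmx E) = 1%:M.
Proof. by move=> uE e; rewrite mulmxA -(mulmxA E) e mulmx1 mulmxV. Qed.

Lemma comm_mul_invmx E F S : E \in unitmx -> E *m S = S *m E -> S *m F = F *m S ->
  S *m (F *m invmx E) = (F *m invmx E) *m S.
Proof.
move=> uE SE SF; rewrite mulmxA SF -!mulmxA; congr (_ *m _).
rewrite -[LHS]mul1mx -(mulVmx uE) -!mulmxA; congr (_ *m _).
by rewrite mulmxA SE -mulmxA mulmxV // mulmx1.
Qed.

Lemma mul_invmxK E F : E \in unitmx -> (F *m invmx E) *m E = F.
Proof. by move=> uE; rewrite -mulmxA mulVmx // mulmx1. Qed.

End MatrixFactor.

Section LinearFields.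
Variables (K : fieldType) (n : nat).
Implicit Types (f : fps K n) (A B : 'M[K]_n) (eta u : formal_map K n).

Definition linact A : fps K n -> fps K n := vfield_act (linear_formal_map A).

Lemma linact_der A : fder id (linact A).
Proof. exact: vfield_act_der (linear_formal_vfield A). Qed.

Lemma linact_linear A B k : linact A (linear_formal_map B k) = linear_formal_map (B *m A) k.
Proof.
rewrite linear_formal_mxact (flin_mxact _ _ _ (linact_der A).1).
rewrite [RHS](_ : _ = mxact B (linear_formal_map A) k).
  by apply: eq_bigr => i _; rewrite /linact vfield_act_var.
by rewrite !linear_formal_mxact mxactM.
Qed.

Lemma linactD A B f : linact (A + B) f = linact A f + linact B f.
Proof.
rewrite /linact !vfield_actE -big_split; apply: eq_bigr => j _ /=.
rewrite -mulrDl; congr (_ * _); rewrite !linear_formal_mxact -big_split.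
by apply: eq_bigr => k _; rewrite mxE scalerDl.
Qed.

Lemma linear_comp_mxactK A B eta k : A *m B = 1%:M -> formal_vfield eta ->
  fps_comp (linear_formal_map A k) (mxact B eta) = eta k.
Proof.
move=> AB he; rewrite -[LHS]/(formal_map_comp (linear_formal_map A) (mxact B eta) k).
by rewrite linear_comp -?mxactM ?AB ?mxact1 //; apply: mxact_vfield.
Qed.

Lemma iter_linact A m k : iter m (linact A) (fps_var k) = linear_formal_map (A ^+ m) k.
Proof.
elim: m => [|m IH]; first by rewrite expr0 linear1.
by rewrite iterS IH linact_linear exprSr mulmxE.
Qed.

(** The commutator is a derivation, hence vanishes once it does so on the variables. *)
Lemma fder_comm D1 D2 : fder id D1 -> fder id D2 ->
  (forall k, D1 (D2 (fps_var k)) = D2 (D1 (fps_var k))) ->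
  forall f : fps K n, D1 (D2 f) = D2 (D1 f).
Proof.
move=> [h1 m1] [h2 m2] e f.
pose L f := D1 (D2 f) + -1 *: D2 (D1 f).
have dL : fder id L.
  split=> [|g h].
    by apply: flin_add; [apply: flin_comp | apply: flin_scale; apply: flin_comp].
  rewrite /L m2 m1 !(flinD h1) !(flinD h2) !m1 !m2 !scaleN1r; ring.
have d0 : fder id (fun=> 0 : fps K n).
  split=> [|g h]; last by rewrite mulr0 mul0r addr0.
  by split=> // x g h; rewrite scaler0 addr0.
have := fder_ext (fhom_id _ _) dL d0 _ f.
rewrite /L scaleN1r => H; apply/eqP; rewrite -subr_eq0; apply/eqP; apply: H => k.
by rewrite e scaleN1r subrr.
Qed.

Lemma linact_comm A B f : A *m B = B *m A -> linact A (linact B f) = linact B (linact A f).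
Proof.
move=> AB; apply: fder_comm; try exact: linact_der.
by move=> k; rewrite /linact !vfield_act_var -!/(linact _) !linact_linear AB.
Qed.

Lemma linact_diag (gam : 'I_n -> K) f a :
  linact (diag_mx (\row_k gam k)) f a = weight gam a * f a.
Proof.
rewrite /linact vfield_actE coef_sum /weight mulr_suml; apply: eq_bigr => j _.
rewrite linear_formal_mxact mxact_diag mxE -scalerAl coefZ coef_var_deriv.
by rewrite mulrA [gam j * _]mulrC.
Qed.

(** Both sides are derivations relative to the substitution of u, so the variables decide. *)
Lemma linact_comp A B u f : formal_vfield u ->
  (forall k, linact A (u k) = mxact B u k) -> linact A (fps_comp f u) = fps_comp (linact B f) u.
Proof.
move=> hu h; have hT := fps_comp_hom hu.
apply: (fder_ext hT (fder_comp_hom hT (linact_der A)) (fder_hom_comp hT (linact_der B))) => k.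
rewrite fps_comp_var // h /linact vfield_act_var.
by rewrite -[RHS]/(formal_map_comp _ _ k) linear_comp.
Qed.

(** In the coordinates w, strong resonance says that component j is an eigenvector of the derivation
    S for gam_j; returned to z, this is the commutation of u with S. *)
Lemma resonant_linact (S P : 'M[K]_n) gam u : P \in unitmx ->
  S *m P = P *m diag_mx (\row_k gam k) -> formal_vfield u ->
  strongly_resonant gam (in_coordinates P u) -> forall k, linact S (u k) = mxact S u k.
Proof.
move=> uP SP hu sr k; set Q := invmx P.
have [QP PQ] : Q *m P = 1%:M /\ P *m Q = 1%:M by split; rewrite ?mulVmx ?mulmxV.
have hlP := linear_formal_vfield P; have hlQ := linear_formal_vfield Q.
have hs := fps_comp_vfield hlP hu.
pose w := in_coordinates P u.
have hw : formal_vfield w by apply: fps_comp_vfield => //; apply: linear_formal_vfield.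
have wE : w = mxact Q (formal_map_comp u (linear_formal_map P)) by apply: linear_comp.
pose w' := formal_map_comp w (linear_formal_map Q).
have uE : u = mxact P w'.
  rewrite /w' wE; have -> : formal_map_comp (mxact Q (formal_map_comp u (linear_formal_map P)))
      (linear_formal_map Q) = mxact Q u.
    apply/funext => j; apply: etrans (flin_mxact _ _ _ (fps_comp_flin hlQ)) _.
    apply: eq_bigr => i _; rewrite fps_compA // linear_compM PQ linear1.
    by rewrite fps_comp_id.
  by rewrite -mxactM PQ mxact1.
have dw j : linact (diag_mx (\row_k gam k)) (w j) = gam j *: w j.
  apply/funext => a; rewrite linact_diag coefZ.
  by have [->|/sr ->] := eqVneq (w j a) 0; rewrite ?mulr0.
have Sw' j : linact S (w' j) = gam j *: w' j.
  rewrite /w' /formal_map_comp (linact_comp (B := diag_mx (\row_k gam k))) // => [|i].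
    by rewrite dw (flinZ (fps_comp_flin hlQ)).
  rewrite linact_linear -linear_comp // linear_compM; congr (linear_formal_map _ i).
  by rewrite -[Q *m S]mulmx1 -PQ -!mulmxA (mulmxA S) SP !mulmxA QP mul1mx.
rewrite {1}uE (flin_mxact _ _ _ (linact_der S).1) [in RHS]uE -mxactM SP mxactM.
by apply: eq_bigr => j _; rewrite Sw' mxact_diag mxE.
Qed.

End LinearFields.

(** The reals inside R[i], closed under division as [flog_over] requires. *)
Definition realC (R : realType) : divringClosed R[i] :=
  GRing.DivringClosed.clone R[i] (@Num.Def.real_num_pred R[i]) _.

Section RealMatrices.
Variables (R : realType) (n : nat).
Local Notation C := (R[i]).
Implicit Types A B : 'M[C]_n.

Lemma real_mxM A B : real_mx A -> real_mx B -> real_mx (A *m B).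
Proof. by move=> hA hB i j; rewrite mxE; apply: rpred_sum => k _; rewrite rpredM. Qed.

Lemma real_mxB A B : real_mx A -> real_mx B -> real_mx (A - B).
Proof. by move=> hA hB i j; rewrite !mxE rpredB. Qed.

Lemma real_mx_scalar (x : C) : x \is Num.real -> real_mx (x%:M : 'M[C]_n).
Proof. by move=> hx i j; rewrite mxE; apply: rpredMn. Qed.

Lemma real_nilp_exp A p : real_mx A -> real_mx (nilp_exp A p 1).
Proof.
move=> hA i j; rewrite summxE; apply: rpred_sum => k _; rewrite mxE expr1n.
rewrite rpredM ?rpredV ?rpredM ?rpredV ?rpred1 ?rpred_nat //.
elim: (nat_of_ord k) i j => [|m IH] i j; first by rewrite expr0; apply: real_mx_scalar; rewrite rpred1.
by rewrite exprS -mulmxE; apply: real_mxM.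
Qed.

Lemma real_invmx A : real_mx A -> real_mx (invmx A).
Proof.
move=> hA i j; apply/CrealP.
have e : map_mx Num.conj A = A by apply/matrixP => i' j'; rewrite mxE; apply/CrealP/hA.
by rewrite -{2}e -map_invmx mxE.
Qed.

End RealMatrices.

Section Backward.
Variables (R : realType) (n : nat).
Local Notation C := (R[i]).
Implicit Types (f g : fps C n) (eta psi phi chi X : formal_map C n).
Variables (S N B : 'M[C]_n) (p : nat).
Hypotheses (BSN : B = S + N) (SN : S *m N = N *m S) (Np : N ^+ p = 0).

Lemma exps_linact (A E : 'M[C]_n) : is_expmx A E ->
  forall k, exps (linact A) (fps_var k) (linear_formal_map E k).
Proof.
move=> AE k a; rewrite linear_formal_mxact /mxact coef_sum.
have hs := sercvg_sum (r := index_enum 'I_n) (P := xpredT)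
  (fun j (_ : xpredT j) => sercvgZ (c := fps_var j a) (AE k j)).
under eq_bigr do rewrite coefZ mulrC; apply: sercvg_ext hs => m /=.
rewrite /exp_term iter_linact linear_formal_mxact /mxact coef_sum mulr_suml.
by apply: eq_bigr => j _; rewrite coefZ mulrA [_ * fps_var _ _]mulrC.
Qed.

Lemma is_expmx_nilp (M : 'M[C]_n) q : M ^+ q = 0 -> is_expmx M (nilp_exp M q 1).
Proof.
move=> Mq i j; rewrite /nilp_exp summxE.
have h m : (q <= m)%N -> (M ^+ m) i j / m`!%:R = 0.
  by move=> /subnK <-; rewrite exprD Mq mulr0 mxE mul0r.
have -> : \sum_(k < q) ((1 ^+ k / k`!%:R) *: M ^+ k) i j = \sum_(k < q) (M ^+ k) i j / k`!%:R.
  by apply: eq_bigr => k _; rewrite mxE expr1n mulrC div1r.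
exact: (sercvg_finite h).
Qed.


(** Since S = B + (- N) with commuting terms, e^S comes from the given e^B and the finite sum e^(-
    N); no exponential of S has to be constructed. *)
Lemma exps_semisimple (E : 'M[C]_n) : is_expmx B E ->
  forall k, exps (linact S) (fps_var k) (linear_formal_map (E *m nilp_exp (- N) p 1) k).
Proof.
move=> BE k; have Np' : (- N) ^+ p = 0 by rewrite exprNn Np mulr0.
have hn := exps_linact (is_expmx_nilp Np').
have hlN := linear_formal_vfield (nilp_exp (- N) p 1).
have hc := exps_comp (linact_der (- N)) hlN hn.
have hB : exps (linact B) (fps_var k) (linear_formal_map E k) by apply: exps_linact.
have cNB f : linact (- N) (linact B f) = linact B (linact (- N) f).
  by apply: linact_comm; rewrite BSN mulmxDl mulmxDr mulmxN mulNmx SN mulNmx mulmxN.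
have := exps_add (linact_der _).1 (linact_der _).1 (fps_comp_flin hlN) cNB hc hB.
rewrite -[fps_comp _ _]/(formal_map_comp _ _ k) linear_compM.
have -> : (fun f => linact (- N) f + linact B f) = linact S; last by [].
by apply/funext => f; rewrite -linactD BSN addrC addrK.
Qed.

Variables (P : 'M[C]_n) (gam : 'I_n -> C).
Hypotheses (uP : P \in unitmx) (SP : S *m P = P *m diag_mx (\row_k gam k)).

Lemma exists_log_resonant chi : formal_vfield chi -> is_expmx B (jet1 chi) ->
  jet1 chi \in unitmx -> strongly_resonant gam (in_coordinates P chi) ->
  exists Y, [/\ fder id Y, forall k, exps Y (fps_var k) (chi k),
    jet1 (fun k => Y (fps_var k)) = B &
    real_formal_map chi -> real_mx S -> real_mx N ->
      forall f, fps_over (realC R) f -> fps_over (realC R) (Y f)].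
Proof.
move=> hchi BE uE sr; set E := jet1 chi in BE uE.
have Schi := resonant_linact uP SP hchi sr.
have dS := linact_der S.
have jS : jet1 (fun k => linact S (fps_var k)) = S.
  rewrite -[RHS](jet1_linear S); congr jet1; apply/funext => k.
  by rewrite /linact vfield_act_var.
have SE : E *m S = S *m E.
  have := jet1_flin dS.1 hchi; have -> : (fun j => linact S (chi j)) = mxact S chi by apply/funext.
  by rewrite jet1_mxact jS.
pose eN := nilp_exp N p 1; pose eN' := nilp_exp N p (- 1).
have eNN' : eN' *m eN = 1%:M by rewrite nilp_expD // addNr nilp_exp0.
(* [ES] is e^S = e^B e^(- N), and [ESi] = e^N e^(- B) is its inverse. *)
pose ES := E *m eN'; pose ESi := eN *m invmx E.
have ES_ESi : ES *m ESi = 1%:M by apply: mul_factorV.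
have S_ESi : S *m ESi = ESi *m S.
  by apply: comm_mul_invmx => //; apply: nilp_exp_comm.
(* The unipotent factor u = e^(- S) o chi, with linear part e^N; it commutes with S because chi and
   e^(- S) do. *)
pose u := mxact ESi chi.
have hu : formal_vfield u by apply: mxact_vfield.
have ju : jet1 u = eN by rewrite jet1_mxact; apply: mul_invmxK.
have Su k : linact S (u k) = mxact S u k.
  have -> : linact S (u k) = mxact ESi (fun j => linact S (chi j)) k by apply: flin_mxact dS.1.
  have -> : (fun j => linact S (chi j)) = mxact S chi by apply/funext.
  by rewrite -mxactM -S_ESi mxactM.
have unip := unipotent_comp hu (etrans (congr1 (fun M => (M - 1%:M) ^+ p) ju) (nilp_exp_unipotent Np)).
pose Z := flog (fps_comp_hom hu) unip.
have dZ : fder id Z := flog_der _ _.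
have ZS f : Z (linact S f) = linact S (Z f).
  by apply: flog_comm => [|g]; [exact: dS.1 | rewrite (linact_comp _ hu Su)].
have expZ f : exps Z f (fps_comp f u).
  move=> a; have [q hq] := flog_nilpotent (fps_comp_hom hu) unip f a.
  by rewrite -(exp_flog hq); apply: exps_finite.
exists (fun f => Z f + linact S f); split.
- split=> [|f g]; first exact: flin_add dZ.1 dS.1.
  by rewrite dZ.2 dS.2; ring.
- move=> k; have hS : exps (linact S) (fps_var k) (linear_formal_map (E *m nilp_exp (- N) p 1) k).
    exact: exps_semisimple.
  rewrite nilp_expN -/eN' -/ES in hS.
  have := exps_add dZ.1 dS.1 (fps_comp_flin hu) ZS expZ hS.
  (* The exponential of Z + S sends z_k to component k of e^S o u, which is chi_k. *)
  by rewrite (linear_comp_mxactK k ES_ESi hchi).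
- have jZ := flog_jet1 hu unip Np ju; rewrite -/Z in jZ.
  transitivity (jet1 (fun k => Z (fps_var k)) + jet1 (fun k => linact S (fps_var k))).
    by apply/matrixP => i j; rewrite !mxE coefD.
  by rewrite jZ jS BSN addrC.
move=> rchi rS rN f rf; apply: overD; last first.
  apply: over_vfield_act => // j; rewrite linear_formal_mxact; apply: over_sum => k.
  by apply: overZ; [apply: rS | apply: over_var].
apply: flog_over => // g rg; apply: over_comp => // j; apply: over_sum => k.
apply: overZ; last exact: rchi.
by apply: real_mxM; [apply: real_nilp_exp | apply: real_invmx => i' j'; rewrite mxE; apply: rchi].
Qed.

End Backward.

(** * Both implications for a change of coordinates P diagonalizing S *)

Section Equivalence.
Variables (R : realType) (n : nat).
Local Notation C := (R[i]).
Variables (S N B P : 'M[C]_n) (gam : 'I_n -> C) (phi : formal_map C n).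
Hypotheses (BSN : jordan_decomposition B S N).
Hypotheses (uP : P \in unitmx) (SP : S *m P = P *m diag_mx (\row_k gam k)).
Hypotheses (dphi : formal_diffeo phi) (Bphi : is_expmx B (jet1 phi)).

Let vphi : formal_vfield phi := dphi.1.

Lemma tangent_id_diffeo (eta : formal_map C n) : tangent_id eta ->
  formal_diffeo eta /\ jet1 eta = 1%:M.
Proof.
move=> h; have j1 := tangent_id_jet1 h; split; last exact: j1.
by split; [exact: tangent_id_vfield | rewrite j1 unitmx1].
Qed.

(** The normalizing eta is the inverse of the coordinates theta, so that psi = theta. Reality is a
    conditional conclusion, which lets one statement serve both cases. *)
Lemma normalize_exp X : formal_vfield X -> jet1 X = B -> is_exp_vfield X phi ->
  exists eta psi : formal_map C n, [/\ tangent_id eta, tangent_id psi, formal_map_inverse eta psi,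
    strongly_resonant gam (in_coordinates P (formal_map_comp psi (formal_map_comp phi eta))) &
    real_formal_map X -> real_mx S -> real_formal_map eta /\ real_formal_map psi].
Proof.
move=> hX jX eX; have [eB _ [p Np] SN] := BSN.
have [theta [t_theta nilp rtheta]] := exists_twist_nilpotent_real uP SP eB SN Np hX jX.
have [eta [t_eta [theta_eta eta_theta] reta]] := tangent_id_inverse t_theta.
have [v_theta v_eta] := (tangent_id_vfield t_theta, tangent_id_vfield t_eta).
exists eta, theta; split=> // [|rX rS].
  exact: (strongly_resonant_conj uP SP hX vphi eX v_theta v_eta theta_eta eta_theta nilp).
by have rt := rtheta rX rS; split=> //; apply: (reta (realC R)).
Qed.

Lemma exp_of_normalized (eta psi : formal_map C n) : formal_vfield eta -> formal_vfield psi ->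
  jet1 eta = 1%:M -> formal_map_inverse eta psi ->
  strongly_resonant gam (in_coordinates P (formal_map_comp psi (formal_map_comp phi eta))) ->
  exists X, [/\ formal_vfield X, jet1 X = B, is_exp_vfield X phi &
    real_formal_map phi -> real_formal_map eta -> real_formal_map psi ->
    real_mx S -> real_mx N -> real_formal_map X].
Proof.
move=> he hp je [ep pe] sr; have [eB _ [p Np] SN] := BSN.
have jp : jet1 psi = 1%:M by rewrite -[LHS]mul1mx -je -jet1_comp // ep jet1_id.
have vpe : formal_vfield (formal_map_comp phi eta) by apply: fps_comp_vfield.
set chi := formal_map_comp psi _ in sr.
have hchi : formal_vfield chi by apply: fps_comp_vfield.
have jchi : jet1 chi = jet1 phi by rewrite !jet1_comp // je jp mulmx1 mul1mx.
have Bchi : is_expmx B (jet1 chi) by rewrite jchi.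
have uchi : jet1 chi \in unitmx by rewrite jchi; case: dphi.
have [Y [dY eY jY rY]] := exists_log_resonant eB SN Np uP SP hchi Bchi uchi sr.
have [hE hPs] := (fps_comp_hom he, fps_comp_hom hp).
have EK (f : fps C n) : fps_comp (fps_comp f eta) psi = f by rewrite fps_compA // ep fps_comp_id.
have PK (f : fps C n) : fps_comp (fps_comp f psi) eta = f by rewrite fps_compA // pe fps_comp_id.
(* The logarithm Y of chi, carried back to the original coordinates. *)
pose DX f := fps_comp (Y (fps_comp f eta)) psi.
have dDX : fder id DX by apply: (fder_conj hPs hE EK dY).
pose X : formal_map C n := fun j => DX (fps_var j).
have XE : vfield_act X = DX by apply/funext => f; rewrite (fder_vfield_act dDX).
have hX : formal_vfield X.
  by move=> j; apply/ord1P/(flin_ord dDX.1)/ord_var.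
exists X; split; first exact: hX.
- have -> : X = fun j => fps_comp (Y (eta j)) psi.
    by apply/funext => j; rewrite /X /DX fps_comp_var.
  have hYe : formal_vfield (fun j => Y (eta j)) by move=> j; apply/ord1P/(flin_ord dY.1)/ord1P.
  rewrite -[LHS]/(jet1 (formal_map_comp (fun j => Y (eta j)) psi)) jet1_comp // jp mulmx1.
  by rewrite (jet1_flin dY.1) // je mul1mx.
- apply/is_exp_vfieldP => k; rewrite XE.
  have hY : exps Y (eta k) (fps_comp (eta k) chi) by apply: exps_comp.
  (* From eta o psi = id follows eta o chi = phi o eta, hence phi = eta o chi o psi. *)
  have -> : phi k = fps_comp (fps_comp (eta k) chi) psi.
    have -> : fps_comp (eta k) chi = fps_comp (phi k) eta.
      rewrite -[LHS]fps_compA //.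
      by rewrite [fps_comp (eta k) psi](congr1 (fun e : formal_map C n => e k) ep) fps_comp_var.
    by rewrite EK.
  apply: (@exps_conj R n Y (fun f => fps_comp f psi) (fun f => fps_comp f eta)
    (fps_var k) (fps_comp (eta k) chi) dY.1 (fps_comp_flin hp) PK); first by rewrite fps_comp_var.
  exact: EK.
move=> rphi re rp rS rN j; rewrite /X /DX fps_comp_var //.
have rchi : real_formal_map chi.
  by move=> i; apply: (over_comp (S := realC R)) => // k; apply: (over_comp (S := realC R)).
by apply: (over_comp (S := realC R)) => //; apply: rY.
Qed.

End Equivalence.

(** * The coordinates w *)

Section WCoordinates.
Variables (R : realType) (n : nat) (D : {set 'I_n}) (S : 'M[R[i]]_n).
Hypotheses (bD : block_structure D) (SD : real_jordan_form D S).
Local Notation W := (w_coordinates R D).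

Lemma block2_inj p p' q : block2 D p q -> block2 D p' q -> p = p'.
Proof.
move=> /andP [_ /eqP e] /andP [_ /eqP e']; apply/val_inj/succn_inj.
by rewrite /= -e -e'.
Qed.

Lemma block2_neq p q : block2 D p q -> p != q.
Proof. by move=> /andP [_ /eqP e]; apply/eqP => /(congr1 val) /=; rewrite e; apply: n_Sn. Qed.

Lemma block2_notin p q : block2 D p q -> q \notin D.
Proof.
move=> /andP [pD /eqP e]; have [q' e' q'D] := bD pD.
by have -> : q = q' by apply: val_inj; rewrite /= e e'.
Qed.

(* Column k of W is e_k - i e_q, e_p + i e_k or e_k. *)
Lemma w_column (k : 'I_n) :
  [\/ exists2 q, block2 D k q & forall F : 'I_n -> R[i], \sum_j F j * W j k = F k - 'i%C * F q,
      exists2 p, block2 D p k & forall F : 'I_n -> R[i], \sum_j F j * W j k = F p + 'i%C * F k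
    | (forall i, ~~ block2 D i k && ~~ block2 D k i) /\
      forall F : 'I_n -> R[i], \sum_j F j * W j k = F k].
Proof.
have [kD|kD] := boolP (k \in D).
  have [q qk qD] := bD kD; have kq : block2 D k q by rewrite /block2 kD qk eqxx.
  have nk : [exists p, block2 D p k] = false.
    by apply/existsP => -[p /block2_notin]; rewrite kD.
  constructor 1; exists q => // F; rewrite (bigD1 k) //= (bigD1 q) /=; last by rewrite eq_sym block2_neq.
  rewrite big1 => [|j /andP [jk jq]]; rewrite !mxE.
    rewrite eqxx nk eq_sym (negbTE (block2_neq kq)) kq mulr1 addr0.
    rewrite (_ : block2 D q k = false); last by rewrite /block2 (negbTE qD).
    by rewrite mulrN mulrC.
  rewrite (negbTE jk) (_ : block2 D j k = false); last by apply: contraTF kD; apply: block2_notin.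
  rewrite (_ : block2 D k j = false) ?mulr0 //; apply: contraNF jq => /andP [_ /eqP e].
  by apply/eqP/val_inj; rewrite /= e qk.
have [/existsP [p pk]|nk] := boolP [exists p, block2 D p k].
  constructor 2; exists p => // F; rewrite (bigD1 k) //= (bigD1 p) /=; last by rewrite block2_neq.
  rewrite big1 => [|j /andP [jk jp]]; rewrite !mxE.
    rewrite eqxx (negbTE (block2_neq pk)) pk mulr1 addr0.
    have -> : [exists p0, block2 D p0 k] by apply/existsP; exists p.
    by rewrite addrC mulrC.
  rewrite (negbTE jk) (_ : block2 D j k = false); last by apply: contraNF jp => h; rewrite (block2_inj h pk).
  by rewrite (_ : block2 D k j = false) ?mulr0 // /block2 (negbTE kD).
have nk' p : block2 D p k = false by apply: contraNF nk => h; apply/existsP; exists p.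
constructor 3; split=> [i|F]; first by rewrite nk' /block2 (negbTE kD).
rewrite (bigD1 k) //= big1 => [|j jk]; rewrite !mxE ?eqxx ?(negbTE nk) ?mulr1 ?addr0 //.
by rewrite (negbTE jk) nk' /block2 (negbTE kD) mulr0.
Qed.

Lemma block2_fun p q q' : block2 D p q -> block2 D p q' -> q = q'.
Proof. by move=> /andP [_ /eqP e] /andP [_ /eqP e']; apply: val_inj; rewrite /= e e'. Qed.

Let sqr_imag : 'i%C * 'i%C = -1 :> R[i]. Proof. by simpc. Qed.

Let sub_add_eq0 (x y : R[i]) : x - 'i%C * y = 0 -> x + 'i%C * y = 0 -> x = 0 /\ y = 0.
Proof.
move=> e1 e2; have two0 : (2 : R[i]) != 0 by rewrite pnatr_eq0.
have x0 : x = 0.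
  apply: (mulfI two0); rewrite mulr0 -[RHS]addr0 -{1}e1 -e2.
  by rewrite addrCA subrK mulr_natl.
split=> //; apply: (mulfI (x := - 1)); first by rewrite oppr_eq0 oner_eq0.
by rewrite -sqr_imag -mulrA; move: e2; rewrite x0 add0r => ->; rewrite !mulr0.
Qed.

(** If v W = 0, the two columns of a block {p, q} give v_p - i v_q = 0 and v_p + i v_q = 0. *)
Lemma w_coordinates_unit : W \in unitmx.
Proof.
rewrite -row_free_unit; apply: inj_row_free => v vW.
have vk k : \sum_j v 0 j * W j k = 0 by have /rowP/(_ k) := vW; rewrite !mxE.
apply/rowP => k; rewrite [RHS]mxE.
have [[q kq F1]|[p pk F1]|[nb F1]] := w_column k.
- have [[r /andP [qD _] _]|[p pq F2]|[/(_ k)]] := w_column q.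
  + by have := block2_notin kq; rewrite qD.
  + rewrite (block2_inj pq kq) in F2.
    have e1 := F1 (v 0); have e2 := F2 (v 0); rewrite !vk in e1 e2.
    by case: (sub_add_eq0 (esym e1) (esym e2)).
  + by rewrite kq.
- have [[r pr F2]|[r rp _]|[/(_ k)]] := w_column p.
  + rewrite (block2_fun pr pk) in F2.
    have e1 := F1 (v 0); have e2 := F2 (v 0); rewrite !vk in e1 e2.
    by case: (sub_add_eq0 (esym e2) (esym e1)).
  + by have := block2_notin rp; case/andP: pk => ->.
  + by rewrite pk andbF.
by have := F1 (v 0); rewrite vk => <-.
Qed.

Lemma block_support p q i : block2 D p q -> [\/ i = p, i = q |
  [/\ i != p, i != q, S i p = 0 & S i q = 0]].
Proof.
move=> pq; have [->|ip] := eqVneq i p; first by constructor 1.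
have [->|iq] := eqVneq i q; first by constructor 2.
have [_ _ S0] := SD; have [pD qD] : p \in D /\ q \notin D.
  by split; [case/andP: pq | apply: block2_notin pq].
constructor 3; split=> //; apply: S0 => //.
- by apply: contraTN pD; apply: block2_notin.
- by apply: contra iq => /(block2_fun pq) ->.
- by apply: contra ip => h; rewrite (block2_inj h pq).
- by rewrite /block2 (negbTE qD).
Qed.

(** For the block with rows (lambda, - mu) and (mu, lambda), the first column of W has eigenvalue
    lambda + i mu and the second lambda - i mu. *)
Lemma w_eigenvector k : exists c, forall i, \sum_j S i j * W j k = W i k * c.
Proof.
have WE i : W i k = \sum_j (i == j)%:R * W j k.
  rewrite (bigD1 i) //= eqxx mul1r big1 ?addr0 // => j; rewrite eq_sym => /negbTE ->.
  by rewrite mul0r.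
have [_ S1 S0] := SD.
have [[q kq F1]|[p pk F1]|[nb F1]] := w_column k.
- have [Sqq Skq] := S1 _ _ kq; have kq' := block2_neq kq.
  exists (S k k - 'i%C * S k q) => i; rewrite (WE i) !F1.
  have [->|->|[/negbTE ik /negbTE iq -> ->]] := block_support i kq.
  + by rewrite eqxx (negbTE kq') mulr0 subr0 mul1r.
  + rewrite eqxx eq_sym (negbTE kq') mulr1 sub0r Sqq Skq mulrN opprK mulrDr.
    by rewrite !mulNr mulrA sqr_imag mulN1r opprK addrC.
  + by rewrite ik iq !mulr0 subr0 mul0r.
- have [Skk Spk] := S1 _ _ pk; have pk' := block2_neq pk.
  exists (S p p + 'i%C * S p k) => i; rewrite (WE i) !F1.
  have [->|->|[/negbTE ip /negbTE ik -> ->]] := block_support i pk.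
  + by rewrite eqxx (negbTE pk') mulr0 addr0 mul1r.
  + rewrite eqxx eq_sym (negbTE pk') mulr1 add0r Skk Spk mulrDr.
    by rewrite mulrA sqr_imag mulN1r opprK addrC.
  + by rewrite ip ik !mulr0 addr0 mul0r.
exists (S k k) => i; rewrite (WE i) !F1; have [->|ik] := eqVneq i k; first by rewrite mul1r.
by rewrite mul0r S0 //; case/andP: (nb i).
Qed.

Lemma w_coordinates_diag :
  S *m W = W *m diag_mx (\row_k w_eigenvalues D S k).
Proof.
have /choice [c hc] := w_eigenvector.
have SW : S *m W = W *m diag_mx (\row_k c k).
  apply/matrixP => i k; rewrite mul_mx_diag [LHS]mxE hc [RHS]mxE; congr (_ * _).
  by rewrite mxE.
rewrite [LHS]SW; congr (_ *m diag_mx _); apply/rowP => k; rewrite !mxE /w_eigenvalues.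
by rewrite -mulmxA SW mulKmx ?w_coordinates_unit // !mxE eqxx mulr1n.
Qed.

End WCoordinates.

Section TrivialCoordinates.
Variables (K : fieldType) (n : nat).

Lemma in_coordinates1 (phi : formal_map K n) : formal_vfield phi -> in_coordinates 1%:M phi = phi.
Proof.
move=> h; rewrite /in_coordinates invmx1 linear1 formal_map_comp_id formal_map_id_comp //.
Qed.

End TrivialCoordinates.

Theorem theorem1p4 (R : realType) (n : nat) (hn : (0 < n)%N) :
  (* the real case *)
  (forall (phi : formal_map R[i] n) (B S N : 'M[R[i]]_n) (D : {set 'I_n}),
     real_diffeo phi ->
     real_mx B ->
     jordan_decomposition B S N ->
     block_structure D ->
     real_jordan_form D S ->
     is_expmx B (jet1 phi) ->
     (exists X : formal_map R[i] n,
        [/\ real_vfield X, jet1 X = B & is_exp_vfield X phi])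
     <->
     (exists eta psi : formal_map R[i] n,
        [/\ real_diffeo eta, jet1 eta = 1%:M,
            real_diffeo psi, formal_map_inverse eta psi &
            strongly_resonant (w_eigenvalues D S)
              (in_coordinates (w_coordinates R D)
                 (formal_map_comp psi (formal_map_comp phi eta)))]))
  /\
  (* the complex case, in which w = z *)
  (forall (phi : formal_map R[i] n) (B S N : 'M[R[i]]_n),
     formal_diffeo phi ->
     jordan_decomposition B S N ->
     is_diag_mx S ->
     is_expmx B (jet1 phi) ->
     (exists X : formal_map R[i] n,
        [/\ formal_vfield X, jet1 X = B & is_exp_vfield X phi])
     <->
     (exists eta psi : formal_map R[i] n,
        [/\ formal_diffeo eta, jet1 eta = 1%:M,
            formal_diffeo psi, formal_map_inverse eta psi &
            strongly_resonant (fun k => S k k)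
              (formal_map_comp psi (formal_map_comp phi eta))])).
Proof.
split.
- move=> phi B S N D [dphi rphi] rB jB bD SD Bphi.
  have uW := w_coordinates_unit R bD; have SW := w_coordinates_diag bD SD.
  have rS : real_mx S by case: SD.
  (* N inherits reality from B and S, so that the unipotent factor e^N is real. *)
  have rN : real_mx N.
    have [eB _ _ _] := jB; have -> : N = B - S by rewrite eB addrAC subrr add0r.
    exact: real_mxB.
  split=> [[X [[hX rX] jX eX]]|[eta [psi [[deta reta] jeta [dpsi rpsi] inv sr]]]].
    have [eta [psi [te tp inv sr rr]]] := normalize_exp jB uW SW dphi hX jX eX.
    have [reta rpsi] := rr rX rS.
    have [deta jeta] := tangent_id_diffeo te; have [dpsi _] := tangent_id_diffeo tp.
    by exists eta, psi.
  have [X [hX jX eX rX]] := exp_of_normalized jB uW SW dphi Bphi deta.1 dpsi.1 jeta inv sr.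
  by exists X; split=> //; split=> //; apply: rX.
move=> phi B S N dphi jB dS Bphi.
(* As w = z, the identity matrix is the change of coordinates. *)
have S1 : S *m 1%:M = 1%:M *m diag_mx (\row_k S k k).
  rewrite mulmx1 mul1mx; apply/matrixP => i j; rewrite !mxE.
  have [->|ij] := eqVneq i j; first by rewrite mulr1n.
  by rewrite mulr0n; move/is_diag_mxP: dS; apply.
have u1 : (1%:M : 'M[R[i]]_n) \in unitmx by apply: unitmx1.
have vcomp (eta psi : formal_map R[i] n) : formal_vfield eta -> formal_vfield psi ->
    formal_vfield (formal_map_comp psi (formal_map_comp phi eta)).
  by move=> he hp; do 2!apply: fps_comp_vfield => //; case: dphi.
split=> [[X [hX jX eX]]|[eta [psi [deta jeta dpsi inv sr]]]].
  have [eta [psi [te tp inv sr _]]] := normalize_exp jB u1 S1 dphi hX jX eX.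
  have [deta jeta] := tangent_id_diffeo te; have [dpsi _] := tangent_id_diffeo tp.
  exists eta, psi; split=> //.
  by rewrite in_coordinates1 in sr; last exact: vcomp deta.1 dpsi.1.
rewrite -[formal_map_comp psi _]in_coordinates1 in sr; last exact: vcomp deta.1 dpsi.1.
have [X [hX jX eX _]] := exp_of_normalized jB u1 S1 dphi Bphi deta.1 dpsi.1 jeta inv sr.
by exists X.
Qed.
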